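(* Let $N\ge 2$ and let $A$ be a free basis of the free group $F_N$. For almost every trajectory $\xi=x_1x_2\dots x_n\dots$ of the non-backtracking simple random walk on $F_N$ with respect to $A$ starting at $1$ (equivalently, for $m_A$-almost every $\xi\in\partial F_N$) the following holds: for every integer $n_0\ge 1$ the subset $$\{\xi(n): n\ge n_0\}\subseteq F_N$$ is spectrally rigid, where $\xi(n)=x_1x_2\dots x_n\in F_N$.
   Context: Unprojectivized Outer space: $\mathrm{cv}_N$ is the set of all minimal free and discrete isometric actions of $F_N$ on $\mathbb R$-trees, where two such actions are considered equal if there is an $F_N$-equivariant isometry between the corresponding trees. Equivalently, each $T\in \mathrm{cv}_N$ is the universal cover of a finite connected graph $\Gamma$ without degree-one and degree-two vertices, equipped with an isomorphism $F_N\to\pi_1(\Gamma)$ and with positive real edge lengths, which are lifted to $T$. For $T\in\mathrm{cv}_N$ and $g\in F_N$, $||g||_T=\inf_{x\in T} d_T(x,gx)$ denotes the translation length of $g$ on $T$. Spectral rigidity: a subset $R\subseteq F_N$ is spectrally rigid if whenever $T_1,T_2\in \mathrm{cv}_N$ satisfy $||g||_{T_1}=||g||_{T_2}$ for every $g\in R$, then $T_1=T_2$ in $\mathrm{cv}_N$. Random walk: a trajectory of the non-backtracking simple random walk on $F_N$ with respect to $A$ starting at $1$ is a semi-infinite freely reduced word $\xi=x_1x_2\dots$ with $x_i\in A^{\pm1}$. The space of such words is identified with the boundary $\partial F_N$. The law of the walk is the uniform measure $m_A$, the Borel probability measure on $\partial F_N$ such that for every nontrivial freely reduced word $v$ over $A$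 of length $n$, the set of all $\xi$ having $v$ as an initial segment has $m_A$-measure $\frac{1}{2N(2N-1)^{n-1}}$. *)

(* Defs.v *)
From HB Require Import structures.
From mathcomp Require Import all_boot all_order all_algebra.
From mathcomp Require Import all_classical all_reals all_analysis.

Set Implicit Arguments.
Unset Strict Implicit.
Unset Printing Implicit Defensive.

Import Order.TTheory GRing.Theory Num.Theory.

Local Open Scope classical_set_scope.
Local Open Scope ring_scope.

(* [(i, true)] stands for [a_i] and [(i, false)] for [a_i^-1]. *)
Definition letter (N : nat) : Type := ('I_N * bool)%type.

Definition linv (N : nat) (l : letter N) : letter N := (l.1, ~~ l.2).

Definition reduced (N : nat) (w : seq (letter N)) : bool :=
  sorted (fun l l' => l' != linv l) w.

Definition letter_val (N : nat) (F : groupType) (a : 'I_N -> F)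
    (l : letter N) : F :=
  if l.2 then a l.1 else (a l.1)^-1%g.

Definition word_val (N : nat) (F : groupType) (a : 'I_N -> F)
    (w : seq (letter N)) : F :=
  (\prod_(l <- w) letter_val a l)%g.

(* [F] is free on [a_0, ..., a_(N-1)]: each element is the product of exactly
   one freely reduced word. *)
Definition free_basis (N : nat) (F : groupType) (a : 'I_N -> F) : Prop :=
  forall g : F, exists! w : seq (letter N), reduced w /\ word_val a w = g.

(* The proof of [1 < N] is a parameter because a [measurableType] must be
   inhabited, and there is no infinite word when [N = 0]. *)
Record boundary (N : nat) (hN : (1 < N)%N) := Boundary {
  traj :> nat -> letter N;
  traj_reduced : forall i : nat, traj i.+1 != linv (traj i) }.

Definition initial_word (N : nat) (hN : (1 < N)%N) (xi : boundary hN) (n : nat) :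
  seq (letter N) := mkseq xi n.

Definition cylinder (N : nat) (hN : (1 < N)%N) (v : seq (letter N)) :
  set (boundary hN) := [set xi | initial_word xi (size v) = v].

Arguments cylinder {N} hN v.

Section BoundaryTopology.
Variables (N : nat) (hN : (1 < N)%N).

Let l0 : letter N := (Ordinal (ltnW hN), true).

Let l0_reduced (i : nat) : (fun=> l0) i.+1 != linv ((fun=> l0) i).
Proof. by rewrite /linv xpair_eqE andbF. Qed.

HB.instance Definition _ := gen_eqMixin (boundary hN).
HB.instance Definition _ := gen_choiceMixin (boundary hN).
HB.instance Definition _ := isPointed.Build (boundary hN) (Boundary hN l0_reduced).

Let cyl (i : nat * boundary hN) := cylinder hN (initial_word i.2 i.1).

Let cyl_cover : \bigcup_(i in [set: nat * boundary hN]) cyl i = setT.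
Proof. by apply/seteqP; split => // xi _; exists (0%N, xi). Qed.

Lemma cylinder_prefix (u v : seq (letter N)) (xi zeta : boundary hN) :
  (size u <= size v)%N -> cylinder hN u xi -> cylinder hN v xi ->
  cylinder hN v zeta -> cylinder hN u zeta.
Proof.
rewrite /cylinder /initial_word /= => uv xu xv zv.
rewrite -[RHS]xu; apply: (@eq_from_nth _ l0); rewrite !size_mkseq // => i iu.
have iv := leq_trans iu uv.
by rewrite !nth_mkseq// -(nth_mkseq l0 zeta iv) zv -[in LHS]xv nth_mkseq.
Qed.

Let cyl_join (i j : nat * boundary hN) (xi : boundary hN) :
  setT i -> setT j -> cyl i xi -> cyl j xi ->
  exists k, [/\ setT k, cyl k xi & cyl k `<=` cyl i `&` cyl j].
Proof.
move=> _ _ ci cj.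
have [ij|/ltnW ji] := leqP (size (initial_word i.2 i.1)) (size (initial_word j.2 j.1)).
- by exists j; split => // z cz; split=> //; exact: (cylinder_prefix ij ci cj cz).
- by exists i; split => // z cz; split=> //; exact: (cylinder_prefix ji cj ci cz).
Qed.

HB.instance Definition _ :=
  isBaseTopological.Build (boundary hN) cyl_cover cyl_join.

End BoundaryTopology.

Definition borel_boundary (N : nat) (hN : (1 < N)%N) :=
  g_sigma_algebraType [set U : set (boundary hN) | open U].

HB.instance Definition _ (N : nat) (hN : (1 < N)%N) :=
  Measurable.on (borel_boundary hN).

Definition uniform_measure (R : realType) (N : nat) (hN : (1 < N)%N)
    (m : probability (borel_boundary hN) R) : Prop :=
  forall v : seq (letter N), reduced v -> v != [::] ->
    m (cylinder hN v) =
    (((2 * N) * (2 * N - 1) ^ (size v).-1)%N%:R^-1)%:E.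

(* [xi(n) = x_1 ... x_n]; the letter [x_i] is [xi i.-1]. *)
Definition walk (N : nat) (hN : (1 < N)%N) (F : groupType) (a : 'I_N -> F)
    (xi : boundary hN) (n : nat) : F :=
  word_val a (initial_word xi n).

Section RTree.
Variables (R : realType) (T : metricType R).
Implicit Types (x y z : T) (S : set T).

Definition geodesic_segment x y S : Prop :=
  exists gamma : R -> T,
    [/\ gamma 0 = x,
        gamma (mdist x y) = y,
        {in `[0, mdist x y] &, forall s t, mdist (gamma s) (gamma t) = `|s - t|} &
        S = gamma @` [set` `[0, mdist x y]]].

(* The definition of an R-tree in Bridson-Haefliger, Example II.1.15(5). *)
Definition is_Rtree : Prop :=
  [/\ [set: T] !=set0,
      forall x y, exists! S, geodesic_segment x y S &
      forall x y z S1 S2,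
        geodesic_segment y x S1 -> geodesic_segment x z S2 ->
        S1 `&` S2 = [set x] -> geodesic_segment y z (S1 `|` S2)].

Definition is_subtree (Y : set T) : Prop :=
  Y !=set0 /\
  forall x y S, Y x -> Y y -> geodesic_segment x y S -> S `<=` Y.

End RTree.

(* Unprojectivized Outer space. Equality in [cv_N] is [cv_eq], not [=]. *)
Record cv (R : realType) (F : groupType) := Cv {
  tree : metricType R;
  act : F -> tree -> tree;
  tree_Rtree : is_Rtree tree;
  act1 : forall x, act 1%g x = x;
  actM : forall g h x, act (g * h)%g x = act g (act h x);
  act_isometry : forall g x y, mdist (act g x) (act g y) = mdist x y;
  act_free : forall g x, act g x = x -> g = 1%g;
  (* Every orbit is discrete; by equivariance it suffices that each point is
     isolated in its own orbit. For a free isometric action this is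
     equivalent to proper discontinuity. *)
  act_discrete : forall x, exists2 e : R, 0 < e &
    forall g, mdist x (act g x) < e -> act g x = x;
  act_minimal : forall Y : set tree, is_subtree Y ->
    (forall g x, Y x -> Y (act g x)) -> Y = setT }.

Arguments act {R F} c g x.

Definition cv_eq (R : realType) (F : groupType) (T1 T2 : cv R F) : Prop :=
  exists f : tree T1 -> tree T2,
    [/\ set_bij setT setT f,
        forall x y, mdist (f x) (f y) = mdist x y &
        forall g x, f (act T1 g x) = act T2 g (f x)].

Definition translation_length (R : realType) (F : groupType) (T : cv R F)
    (g : F) : R :=
  inf (range (fun x : tree T => mdist x (act T g x))).

Definition spectrally_rigid (R : realType) (F : groupType) (S : set F) : Prop :=
  forall T1 T2 : cv R F,
    (forall g, S g -> translation_length T1 g = translation_length T2 g) ->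
    cv_eq T1 T2.

(* Main.v *)
(** Let [C] be a constant of bounded cancellation for a tree [T]: if the word
    [uv] is reduced then the segments [[p, u p]] and [[u p, uv p]] overlap in at
    most [C].  Almost every trajectory contains every reduced word, hence has
    prefixes [s c^m] and [s c^(m+1)] with [s] and [m] as large as we like, for
    every cyclically reduced [c].  The backtracking at the two corners of the
    cyclic word [s c^m] is bounded, and does not change when [m] becomes [m+1];
    so [||s c^(m+1)|| - ||s c^m|| = ||c||], and the lengths of the tail of the
    trajectory determine the whole translation length function.

    To recover [T] from the translation lengths, take [g], [h] with disjoint
    axes, and let [p] be the projection of the axis of [h] to that of [g].  Then
    [d(p, k p)] is the maximum of [||z k|| - ||z||] over six elements [z] whose
    axes pass through [p] in three different directions, and the distances
    [d(p, k p)] determine the tree spanned by the orbit of [p]. *)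

Require Import Defs.
From mathcomp Require Import all_boot all_order all_algebra.
From mathcomp Require Import all_classical all_reals all_analysis.
From mathcomp Require Import lra zify.

Set Implicit Arguments.
Unset Strict Implicit.
Unset Printing Implicit Defensive.

Import Order.TTheory GRing.Theory Num.Theory.

(** * R-trees *)

Section TreeGeometry.
Local Open Scope classical_set_scope.
Local Open Scope ring_scope.
Context {R : realType} {T : metricType R}.
Implicit Types (x y z w c : T) (S : set T).
Local Notation d := (@mdist R T).

Definition btw x w y := d x w + d w y = d x y.

(** The base point is the first argument. In a tree this is the length of the common initial part of
    the segments [[x, y]] and [[x, z]]. *)
Definition gromov x y z : R := (d x y + d x z - d y z) / 2.

Lemma triangle_via y x z : d x z <= d x y + d y z.
Proof. exact: metric_triangle. Qed.

Lemma btwC x w y : btw x w y -> btw y w x.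
Proof. by rewrite /btw (metric_sym y w) (metric_sym w x) (metric_sym y x) addrC. Qed.

Lemma btw_trans x v w y : btw x w y -> btw x v w -> btw x v y.
Proof.
rewrite /btw => xwy xvw.
have := triangle_via v x y; have := triangle_via w v y; lra.
Qed.

Lemma gromovC x y z : gromov x y z = gromov x z y.
Proof. rewrite /gromov (metric_sym z y); lra. Qed.

Lemma gromov_ge0 x y z : 0 <= gromov x y z.
Proof. have := triangle_via x y z; rewrite /gromov (metric_sym y x); lra. Qed.

Lemma gromov_lel x y z : gromov x y z <= d x y.
Proof. have := triangle_via y x z; rewrite /gromov; lra. Qed.

Lemma gromov_xx x y : gromov x y y = d x y.
Proof. rewrite /gromov mdistxx; lra. Qed.

Lemma gromov_base x x' y z : gromov x y z <= d x x' + gromov x' y z.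
Proof.
have := triangle_via x' x y; have := triangle_via x' x z.
rewrite /gromov; lra.
Qed.

Lemma segment_btw x y S w : geodesic_segment x y S -> S w -> btw x w y.
Proof.
rewrite /btw; case=> gam [g0 g1 iso ->] [s /=]; rewrite in_itv/= => /andP[s0 s1] <-.
have d0 : 0 <= d x y by exact: mdist_ge0.
have := iso 0 s; rewrite g0 sub0r normrN ger0_norm// => -> //; last 2 first.
- by rewrite in_itv/= lexx.
- by rewrite in_itv/= s0.
have := iso s (d x y); rewrite g1 distrC ger0_norm ?subr_ge0// => -> //; first by lra.
- by rewrite in_itv/= s0.
- by rewrite in_itv/= lexx andbT.
Qed.

Lemma segment_at x y S t : geodesic_segment x y S -> 0 <= t <= d x y ->
  exists w, [/\ S w, d x w = t & d w y = d x y - t].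
Proof.
case=> gam [g0 g1 iso ->] /andP[t0 t1]; exists (gam t).
have d0 : 0 <= d x y by exact: mdist_ge0.
have tI : t \in `[0, d x y] by rewrite in_itv/= t0.
split; first by exists t.
- have := iso 0 t; rewrite g0 sub0r normrN ger0_norm// => -> //.
  by rewrite in_itv/= lexx.
- have := iso t (d x y); rewrite g1 distrC ger0_norm ?subr_ge0// => -> //.
  by rewrite in_itv/= lexx andbT.
Qed.

Lemma segment_inj x y S w w' : geodesic_segment x y S -> S w -> S w' ->
  d x w = d x w' -> w = w'.
Proof.
case=> gam [g0 g1 iso ->] [s sI <-] [s' s'I <-].
have d0 : 0 <= d x y by exact: mdist_ge0.
have I0 : 0 \in `[0, d x y] by rewrite in_itv/= lexx.
have [Hs Hs'] := (iso 0 s I0 sI, iso 0 s' I0 s'I).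
rewrite -[in d x (gam s)]g0 -[in d x (gam s')]g0 Hs Hs' !sub0r !normrN.
move: sI s'I; rewrite /= !in_itv/= => /andP[s0 _] /andP[s'0 _].
by rewrite !ger0_norm// => ->.
Qed.

Lemma segment_end x y S : geodesic_segment x y S -> S x /\ S y.
Proof.
case=> gam [g0 g1 iso ->]; have d0 : 0 <= d x y by exact: mdist_ge0.
split; [exists 0 | exists (d x y)] => //=; by rewrite in_itv/= ?lexx ?andbT.
Qed.

(** This holds in every metric space: a shortcut between the two pieces would make [d x y] smaller
    than [d x w + d w y]. *)
Lemma segment_cat x w y S1 S2 : geodesic_segment x w S1 ->
  geodesic_segment w y S2 -> btw x w y -> geodesic_segment x y (S1 `|` S2).
Proof.
case=> g1 [g10 g11 iso1 ->] [g2 [g20 g21 iso2 ->]] xwy.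
have d1 : 0 <= d x w by exact: mdist_ge0.
have d2 : 0 <= d w y by exact: mdist_ge0.
set a := d x w in d1 *; set b := d w y in d2 *.
have ab : d x y = a + b by rewrite -xwy.
pose g t := if t <= a then g1 t else g2 (t - a).
have gr t : a <= t -> g t = g2 (t - a).
  rewrite /g; case: (leP t a) => // ta at_; have -> : t = a by lra.
  by rewrite g11 subrr g20.
have gl t : t <= a -> g t = g1 t by rewrite /g => ->.
have iso_le s t : 0 <= s -> s <= t -> t <= a + b -> d (g s) (g t) = t - s.
  move=> s0 st tab.
  have [ta|/ltW ta] := leP t a.
    rewrite !gl//; last exact: le_trans ta.
    rewrite iso1; first by rewrite distrC ger0_norm// subr_ge0.
    - by rewrite in_itv/= s0 (le_trans st).
    - by rewrite in_itv/= ta (le_trans s0).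
  have [sa|/ltW sa] := leP s a; last first.
    rewrite !gr// iso2; first by rewrite distrC ger0_norm; lra.
    - rewrite in_itv/=; apply/andP; split; rewrite -/b; lra.
    - rewrite in_itv/=; apply/andP; split; rewrite -/b; lra.
  rewrite gl// gr//.
  have e1 : d x (g1 s) = s.
    rewrite -[in d x _]g10 iso1; first by rewrite sub0r normrN ger0_norm.
    - by rewrite in_itv/= lexx.
    - by rewrite in_itv/= s0.
  have e2 : d (g1 s) w = a - s.
    rewrite -[in d _ w]g11 iso1; first by rewrite distrC ger0_norm// subr_ge0.
    - by rewrite in_itv/= s0.
    - by rewrite in_itv/= d1 lexx.
  have e3 : d w (g2 (t - a)) = t - a.
    rewrite -[in d w _]g20 iso2; first by rewrite sub0r normrN ger0_norm; lra.
    - by rewrite in_itv/= lexx.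
    - by rewrite in_itv/=; apply/andP; split; rewrite -/b; lra.
  have e4 : d (g2 (t - a)) y = b - (t - a).
    rewrite -[in d _ y]g21 iso2; first by rewrite distrC ger0_norm -/b; lra.
    - by rewrite in_itv/=; apply/andP; split; rewrite -/b; lra.
    - by rewrite in_itv/= d2 lexx.
  have := triangle_via w (g1 s) (g2 (t - a)).
  have := triangle_via (g1 s) x y.
  have := triangle_via (g2 (t - a)) (g1 s) y; lra.
exists g; split.
- by rewrite gl// g10.
- by rewrite ab gr ?lerDl// addrC addKr g21.
- move=> s t; rewrite !in_itv/= ab => /andP[s0 s1] /andP[t0 t1].
  have [st|/ltW ts] := leP s t.
    by rewrite iso_le// distrC ger0_norm// subr_ge0.
  by rewrite metric_sym iso_le// ger0_norm// subr_ge0.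
- apply/seteqP; split=> v /=; rewrite ab.
    case=> -[s /=]; rewrite in_itv/= => /andP[s0 s1] <-.
      exists s; last by rewrite gl.
      by rewrite /= in_itv/= s0 (le_trans s1)// lerDl.
    exists (a + s); first by rewrite /= in_itv/= addr_ge0//= lerD2l.
    by rewrite gr ?lerDl// addrC addKr.
  case=> t; rewrite in_itv/= => /andP[t0 t1] <-.
  have [ta|/ltW ta] := leP t a.
    by left; exists t; rewrite ?gl//= in_itv/= t0.
  right; exists (t - a); rewrite ?gr//= in_itv/=; apply/andP; rewrite -/b; lra.
Qed.

Hypothesis treeT : is_Rtree T.

Lemma tree_segment x y : exists S, geodesic_segment x y S.
Proof. by case: treeT => _ /(_ x y)[S [SP _]] _; exists S. Qed.

Lemma tree_point x y t : 0 <= t <= d x y ->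
  exists w, d x w = t /\ d w y = d x y - t.
Proof.
have [S SP] := tree_segment x y.
by move=> /(segment_at SP)[w [_ ? ?]]; exists w.
Qed.

(** Joining segments at [w] gives a segment from [x] to [y] through [w], and uniqueness identifies
    it with [S]. From here on, equations between distances replace membership in segments. *)
Lemma btw_in_segment x y S w : geodesic_segment x y S -> btw x w y -> S w.
Proof.
move=> SP xwy; have [S1 S1P] := tree_segment x w.
have [S2 S2P] := tree_segment w y.
have SS := segment_cat S1P S2P xwy.
case: treeT => _ /(_ x y)[S0 [_ S0u]] _.
rewrite -(S0u _ SP) (S0u _ SS); left; exact: (segment_end S1P).2.
Qed.

Lemma btw_inj x y w w' : btw x w y -> btw x w' y -> d x w = d x w' -> w = w'.
Proof.
have [S SP] := tree_segment x y.
by move=> /(btw_in_segment SP) ? /(btw_in_segment SP); exact: segment_inj SP _.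
Qed.

(** The centre [c] is the last point at which [[x, y]] and [[x, z]] agree. Maximality makes [[y, c]]
    and [[c, z]] meet only in [c], so the third axiom of R-trees joins them into a segment. *)
Lemma tripod x y z : exists c, [/\ btw x c y, btw x c z & btw y c z].
Proof.
pose I : set R := [set t | exists w, [/\ d x w = t, btw x w y & btw x w z]].
have bxx u : btw x x u by rewrite /btw mdistxx add0r.
have supI : has_sup I.
  split; first by exists (d x x); exists x.
  exists (d x y) => t [w [<- + _]]; rewrite /btw => <-.
  by rewrite lerDl mdist_ge0.
set tau := sup I.
have tau_ub t : I t -> t <= tau by move=> It; apply: ub_le_sup => //; exact: supI.2.
have tau0 : 0 <= tau by apply: tau_ub; exists x; rewrite mdistxx.
have tau_y : tau <= d x y.
  apply: ge_sup; first exact: supI.1.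
  by move=> t [w [<- + _]]; rewrite /btw => <-; rewrite lerDl mdist_ge0.
have tau_z : tau <= d x z.
  apply: ge_sup; first exact: supI.1.
  by move=> t [w [<- _]]; rewrite /btw => <-; rewrite lerDl mdist_ge0.
have [c [xc cy]] : exists w, d x w = tau /\ d w y = d x y - tau.
  by apply: tree_point; rewrite tau0.
have [c' [xc' c'z]] : exists w, d x w = tau /\ d w z = d x z - tau.
  by apply: tree_point; rewrite tau0.
have xcy : btw x c y by rewrite /btw xc cy; lra.
have xc'z : btw x c' z by rewrite /btw xc' c'z; lra.
(* the agreement set is closed: the two points at distance [sup I] are at
   distance at most [2 * (tau - t)] for every [t] in it *)
have cc' : c = c'.
  apply: mdist_positivity; apply/eqP; rewrite eq_le mdist_ge0 andbT.
  apply/ler_addgt0Pr => e e0; rewrite add0r.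
  have e20 : 0 < e / 2 by lra.
  have [t [w [xw xwy xwz]] tt] := sup_adherent e20 supI.
  have wtau : t <= tau by apply: tau_ub; exists w.
  have near u v : btw x w u -> btw x v u -> d x v = tau -> d w v = tau - t.
    move=> xwu xvu xv.
    have [v' [xv' v'u]] : exists v', d w v' = tau - t /\ d v' u = d w u - (tau - t).
      apply: tree_point; apply/andP; split; first lra.
      have := mdist_ge0 v u; move: xwu xvu; rewrite /btw; lra.
    suff -> : v = v' by [].
    have := triangle_via w x v'; have := triangle_via v' x u => h1 h2.
    have bv' : btw x v' u by move: xwu; rewrite /btw; lra.
    apply: (btw_inj xvu bv'); move: xwu bv'; rewrite /btw; lra.
  have := near _ _ xwy xcy xc; have := near _ _ xwz xc'z xc'.
  have := triangle_via w c c'; rewrite (metric_sym c w).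
  rewrite -/tau in tt; lra.
have xcz : btw x c z by rewrite cc'.
exists c; split => //.
have [S1 S1P] := tree_segment y c; have [S2 S2P] := tree_segment c z.
case: treeT => _ _ /(_ c y z S1 S2 S1P S2P) yz.
have {}yz : geodesic_segment y z (S1 `|` S2).
  apply: yz; apply/seteqP; split=> w; last first.
    by move=> ->; split; [exact: (segment_end S1P).2|exact: (segment_end S2P).1].
  case=> /(segment_btw S1P)/btwC cwy /(segment_btw S2P) cwz /=.
  have xwy : btw x w y.
    by move/btwC: xcy => xcy; apply: btwC; apply: (btw_trans xcy); exact: btwC.
  have xwz : btw x w z.
    by move/btwC: xcz => xcz; apply: btwC; apply: (btw_trans xcz); exact: btwC.
  have wt : d x w <= tau by apply: tau_ub; exists w.
  apply/esym/mdist_positivity; have := mdist_ge0 c w.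
  move: xwy xcy cwy; rewrite /btw; lra.
by apply: (segment_btw yz); left; exact: (segment_end S1P).2.
Qed.

(** This is 0-hyperbolicity, with the minimum written as a disjunction so that each case is linear.
    The centres of the tripods [x, y, w] and [x, z, w] both lie on [[x, w]]; the one nearer to [x]
    is then common to all three segments. *)
Lemma gromov_hyp x y w z :
  gromov x y w <= gromov x y z \/ gromov x w z <= gromov x y z.
Proof.
wlog ab : y z / gromov x y w <= gromov x w z.
  move=> H; have [|/ltW] := leP (gromov x y w) (gromov x w z); first exact: H.
  rewrite (gromovC x y w) (gromovC x w z) => /H.
  rewrite !(gromovC x z) (gromovC x _ y); tauto.
left; have [c [xcy xcw ycw]] := tripod x y w.
have [c' [xc'z xc'w zc'w]] := tripod x z w.
have g1 : gromov x y w = d x c.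
  move: xcy xcw ycw; rewrite /gromov /btw (metric_sym y c); lra.
have g2 : gromov x w z = d x c'.
  move: xc'z xc'w zc'w; rewrite /gromov /btw (metric_sym z c') (metric_sym w z).
  lra.
have [v [xv vc']] : exists v, d x v = d x c /\ d v c' = d x c' - d x c.
  by apply: tree_point; rewrite mdist_ge0 -g1 -g2.
have xvc' : btw x v c' by rewrite /btw; lra.
have vc : v = c by apply: (btw_inj (btw_trans xc'w xvc') xcw).
have := btw_trans xc'z xvc'; rewrite vc => xcz.
have := triangle_via c y z; move: xcy xcz.
by rewrite g1 /gromov /btw (metric_sym y c); lra.
Qed.

(** Betweenness of [q] is the vanishing of a Gromov product based at [q], to which hyperbolicity
    applies. *)
Lemma btw_split x y z q : btw x q y -> btw x q z \/ btw z q y.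
Proof.
move=> xqy; have q0 : gromov q x y <= 0.
  by move: xqy; rewrite /btw /gromov (metric_sym q x); lra.
have dE u v : gromov q u v <= 0 -> btw u q v.
  by move=> /(conj (gromov_ge0 q u v)); rewrite /gromov /btw (metric_sym q u); lra.
by case: (gromov_hyp q x z y) => H; [left|right]; apply: dE; exact: le_trans q0.
Qed.

(** Of three Gromov products at [x] the two smallest agree. The lemma serves to replace [w] by a
    point [z] whose segment follows [[x, w]] beyond the place where [y] branches off. *)
Lemma gromov_isosceles x y z w :
  gromov x y w < gromov x w z -> gromov x y z = gromov x y w.
Proof.
move=> lt; have [] := gromov_hyp x y w z; have [] := gromov_hyp x y z w;
  rewrite ?(gromovC x z w); lra.
Qed.

(** The segment from [z] meets [[p, q]] on one side of [y] or the other, and then passes through [y]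
    on its way to the opposite end. Hence the distances to the ends determine those to all points of
    the segment. *)
Lemma dist_btw p y q z : btw p y q ->
  d z y = Num.max (d z p - d y p) (d z q - d y q).
Proof.
move=> pyq; apply/eqP; rewrite eq_le; apply/andP; split; last first.
  rewrite ge_max; have := triangle_via y z p; have := triangle_via y z q.
  by move=> ? ?; apply/andP; split; lra.
rewrite le_max; move: pyq; rewrite /btw (metric_sym y p).
have := gromov_hyp y p z q; rewrite /gromov.
rewrite (metric_sym y z) (metric_sym y p) (metric_sym p z) => -[] ? ?;
  by apply/orP; first [left; lra|right; lra].
Qed.

End TreeGeometry.

(** * Isometric actions on R-trees *)

Section Action.
Local Open Scope classical_set_scope.
Local Open Scope ring_scope.
Context {R : realType} {F : groupType} (T : cv R F).
Implicit Types (x y z w p q : tree T) (g h u v k : F).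
Local Notation d := (@mdist R (tree T)).
Local Notation treeT := (tree_Rtree T).
Local Notation tl := (translation_length T).

Definition disp x g : R := d x (act T g x).

(* [turn x u^-1 v] is the length of the backtracking at the corner [u x] of the
   path through [x], [u x] and [u v x] *)
Definition turn x g h : R := gromov x (act T g x) (act T h x).

Lemma tree_neq0 : [set: tree T] !=set0.
Proof. by case: treeT. Qed.

Lemma actKV g x : act T g (act T g^-1%g x) = x.
Proof. by rewrite -actM mulgV act1. Qed.

Lemma dist_act_l g x y : d (act T g x) y = d x (act T g^-1%g y).
Proof. by rewrite -(act_isometry g x) actKV. Qed.

Lemma dist_orbit x g h : d (act T g x) (act T h x) = disp x (g^-1 * h)%g.
Proof. by rewrite dist_act_l /disp actM. Qed.

Lemma disp_ge0 x g : 0 <= disp x g.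
Proof. exact: mdist_ge0. Qed.

Lemma disp1 x : disp x 1%g = 0.
Proof. by rewrite /disp act1 mdistxx. Qed.

Lemma disp_gt0 x g : g <> 1%g -> 0 < disp x g.
Proof.
by move=> g1; rewrite mdist_gt0; apply/eqP => xg; apply: g1; exact: (act_free (esym xg)).
Qed.

Lemma dispV x g : disp x g^-1%g = disp x g.
Proof. by rewrite /disp -dist_act_l metric_sym. Qed.

Lemma turnE x g h : turn x g h = (disp x g + disp x h - disp x (g^-1 * h)%g) / 2.
Proof. by rewrite /turn /gromov dist_orbit. Qed.

Lemma turnC x g h : turn x g h = turn x h g.
Proof. exact: gromovC. Qed.

Lemma turn_ge0 x g h : 0 <= turn x g h.
Proof. exact: gromov_ge0. Qed.

Lemma turn_isosceles x g h k :
  turn x g h < turn x h k -> turn x g k = turn x g h.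
Proof. exact: (gromov_isosceles treeT). Qed.

Lemma disp_mul x g h : disp x (g * h)%g = disp x g + disp x h - 2 * turn x g^-1%g h.
Proof. rewrite turnE dispV invgK; lra. Qed.

Lemma turn_mull x g h : turn x g (g * h)%g = disp x g - turn x g^-1%g h.
Proof. rewrite turnE mulKg disp_mul; lra. Qed.

Lemma disp_act g x h : disp (act T g x) h = disp x (g^-1 * h * g)%g.
Proof. by rewrite /disp !actM -dist_act_l -!actM. Qed.

Lemma tl_le x g : tl g <= disp x g.
Proof.
apply: ge_inf; last by exists x.
by exists 0 => _ [y _ <-]; exact: mdist_ge0.
Qed.

(** The hypothesis puts [x] on the axis of [g]. The segment from [x] to any [z] leaves in a
    direction other than that of [g x] or other than that of [g^-1 x]; in either case [z] moves at
    least as far as [x]. *)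
Lemma tl_disp x g : turn x g g^-1%g <= 0 -> tl g = disp x g.
Proof.
move=> tx; apply/eqP; rewrite eq_le tl_le /=.
apply: lb_le_inf; first by exists (disp x g); exists x.
move=> _ [z _ <-].
have [zg|zg] : gromov x (act T g x) z <= 0 \/ gromov x z (act T g^-1%g x) <= 0.
  by case: (gromov_hyp treeT x (act T g x) z (act T g^-1%g x)) => H;
    [left|right]; apply: (le_trans H tx).
- have := triangle_via (act T g z) z (act T g x).
  rewrite act_isometry; move: zg; rewrite /gromov /disp.
  rewrite (metric_sym (act T g x) z) (metric_sym z x); lra.
- have := triangle_via z (act T g z) x.
  rewrite dist_act_l; move: zg; rewrite /gromov -/(disp x g^-1%g) dispV.
  rewrite (metric_sym (act T g z) z) (metric_sym z x); lra.
Qed.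

Lemma disp_sqr x g : disp x (g * g)%g = 2 * disp x g - 2 * turn x g g^-1%g.
Proof. rewrite disp_mul turnC; lra. Qed.

(** Otherwise the backtracking would cover half of [[x, g x]], and [g] would fix the midpoint [m],
    against freeness. *)
Lemma turn_lt_disp x g : g <> 1%g -> 2 * turn x g g^-1%g < disp x g.
Proof.
move=> g1; rewrite ltNge; apply/negP => H; apply: g1.
set L := disp x g in H; have L0 : 0 <= L := disp_ge0 x g.
have [m [xm mg]] : exists m, d x m = L / 2 /\ d m (act T g x) = L - L / 2.
  by apply: (tree_point treeT); apply/andP; rewrite -/(disp x g) -/L; split; lra.
apply: (@act_free _ _ T g m).
have bm : btw x m (act T g x) by rewrite /btw xm mg /L /disp; lra.
have bgm : btw (act T g x) (act T g m) (act T g (act T g x)).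
  by rewrite /btw !act_isometry.
apply: mdist_positivity; apply/eqP; rewrite eq_le mdist_ge0 andbT.
have := dist_btw treeT (act T g m) bm => ->; rewrite act_isometry.
have := dist_btw treeT x bgm; rewrite -actM -/(disp x g) -/(disp x (g * g)%g).
rewrite disp_sqr actM !act_isometry -/L (metric_sym (act T g m) x) => ->.
rewrite (metric_sym m x) xm mg.
rewrite ge_max lerBlDr ge_max; apply/andP; split; last lra.
by apply/andP; split; lra.
Qed.

(** The point [p] is the foot of [x] on the axis: it lies on [[x, g x]] at the distance [c] of the
    backtracking. The turn at [p] vanishes because [g * g] moves [x] by [2 * L - 2 * c], hence [p]
    by at least [2 * L - 4 * c]. *)
Lemma axis_point x g : g <> 1%g ->
  exists p, turn p g g^-1%g = 0 /\ disp p g = disp x g - 2 * turn x g g^-1%g.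
Proof.
move=> g1; have := turn_lt_disp x g1; have t0 := turn_ge0 x g g^-1%g.
set c := turn x g g^-1%g in t0 *; set L := disp x g => cL.
have [p [xp pg]] : exists m, d x m = c /\ d m (act T g x) = L - c.
  by apply: (tree_point treeT); apply/andP; rewrite -/(disp x g) -/L; split; lra.
have bp : btw x p (act T g x) by rewrite /btw xp pg /L /disp; lra.
have bgp : btw (act T g x) (act T g p) (act T g (act T g x)).
  by rewrite /btw !act_isometry.
have xgp : d x (act T g p) = L - c.
  have := dist_btw treeT x bgp; rewrite -actM -/(disp x g) -/(disp x (g * g)%g).
  rewrite disp_sqr actM !act_isometry (metric_sym p x) xp pg -/L -/c => ->.
  have -> : 2 * L - 2 * c - (L - c) = L - c by lra.
  by rewrite maxxx.
have pgp : disp p g = L - 2 * c.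
  rewrite /disp metric_sym (dist_btw treeT (act T g p) bp) act_isometry.
  rewrite (metric_sym (act T g p) x) xgp (metric_sym p x) xp pg.
  by rewrite (max_idPl _); lra.
exists p; split=> //; apply/eqP; rewrite eq_le turn_ge0 andbT.
have := disp_sqr p g; rewrite pgp.
have := triangle_via p x (act T (g * g)%g p).
have := triangle_via (act T (g * g)%g p) x (act T (g * g)%g x).
rewrite !act_isometry (metric_sym p x) -!/(disp _ _) disp_sqr -/L -/c xp.
lra.
Qed.

Lemma tlE x g : g <> 1%g -> tl g = disp x g - 2 * turn x g g^-1%g.
Proof. by move=> /(axis_point x)[p [p0 <-]]; apply: tl_disp; rewrite p0. Qed.

Lemma axis_exists g : g <> 1%g -> exists p, turn p g g^-1%g = 0 /\ disp p g = tl g.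
Proof.
have [x _] := tree_neq0.
by move=> g1; have [p [p0 pE]] := axis_point x g1; exists p; rewrite (tlE x g1).
Qed.

Lemma tl_conj g h : tl (h * g * h^-1)%g = tl g.
Proof.
rewrite /translation_length; congr inf; apply/seteqP; split=> _ [x _ <-].
  exists (act T h^-1%g x) => //.
  by rewrite dist_act_l invgK -!actM -mulgA.
exists (act T h x) => //.
by rewrite -actM mulgVK actM act_isometry.
Qed.

Lemma tl1 : tl 1%g = 0.
Proof.
have [x _] := tree_neq0.
apply/eqP; rewrite eq_le -{1}(disp1 x) tl_le /=.
apply: lb_le_inf; first by exists (disp x 1%g); exists x.
by move=> _ [z _ <-]; exact: mdist_ge0.
Qed.

(** The product is read as a cyclic word with two corners. Since the backtracking leaves a part of
    both [u] and [v], the path to [u v x] starts like that to [u x] and the path to its inverse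
    image starts like that to [v^-1 x], so the turn of [u * v] is the one at the second corner. *)
Lemma tl_mul x u v :
  turn x u^-1%g v + turn x v^-1%g u < disp x u ->
  turn x u^-1%g v + turn x v^-1%g u < disp x v ->
  tl (u * v)%g =
    disp x u + disp x v - 2 * turn x u^-1%g v - 2 * turn x v^-1%g u.
Proof.
set a := turn _ _ v; set b := turn _ _ u => abu abv.
have b0 : 0 <= b := turn_ge0 _ _ _.
have E := disp_mul x u v; rewrite -/a in E.
have uv1 : (u * v <> 1)%g by move=> uv1; move: E; rewrite uv1 disp1; lra.
rewrite (tlE x uv1) E; suff -> : turn x (u * v)%g (u * v)^-1%g = b by lra.
have h1 : turn x u (u * v)%g = disp x u - a by rewrite turn_mull.
have h2 : turn x v^-1%g (u * v)^-1%g = disp x v - a.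
  by rewrite invgM turn_mull dispV invgK turnC.
have h3 : turn x v^-1%g (u * v)%g = b.
  by apply: turn_isosceles; rewrite -/b h1; lra.
rewrite -h3 [in RHS]turnC; apply: turn_isosceles.
by rewrite turnC h3 h2; lra.
Qed.

Lemma disp_expn p g n : g <> 1%g -> turn p g g^-1%g = 0 ->
  disp p (g ^+ n)%g = n%:R * disp p g.
Proof.
move=> g1 t0; have L0 := disp_gt0 p g1.
(* Two consecutive exponents are carried along, because the turn between [g] and [g ^+ n.+1]
   involves [disp p (g ^+ n)]. *)
suff [] : disp p (g ^+ n)%g = n%:R * disp p g /\
  disp p (g ^+ n.+1)%g = n.+1%:R * disp p g by [].
elim: n => [|n [IH1 IH2]]; first by rewrite expg0 expg1 disp1 mul0r mul1r.
split=> //; rewrite expgS disp_mul IH2.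
suff -> : turn p g^-1%g (g ^+ n.+1)%g = 0 by rewrite -(natr1 n.+1); lra.
have -> : turn p g^-1%g (g ^+ n.+1)%g = turn p g^-1%g g; last by rewrite turnC.
apply: turn_isosceles; rewrite turnC t0.
have -> : turn p g (g ^+ n.+1)%g = disp p g.
  by rewrite turnE IH2 expgS mulKg IH1 -natr1; lra.
by [].
Qed.

(** The union of the segments from [p] to its orbit is an invariant subtree, so minimality makes it
    the whole tree. *)
Lemma hull p y : exists g, btw p y (act T g p).
Proof.
pose Y : set (tree T) := [set y | exists g, btw p y (act T g p)].
suff : Y = setT by move=> YT; have : Y y by rewrite YT.
apply: act_minimal; [split|] => [|u v S [g pug] [h pvh] SP w Sw|g w [h pwh]].
- by exists p; exists 1%g; rewrite act1 /btw !mdistxx addr0.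
- case: (btw_split treeT p (segment_btw SP Sw)) => [/btwC|] pw.
    by exists g; exact: (btw_trans pug).
  by exists h; exact: (btw_trans pvh).
- have gw : btw (act T g p) (act T g w) (act T g (act T h p)).
    by rewrite /btw !act_isometry.
  case: (btw_split treeT p gw) => [/btwC|] gpw; first by exists g.
  by exists (g * h)%g; rewrite actM.
Qed.

End Action.

(** * Recovering a tree from the displacements of one point *)

Section Rigidity.
Local Open Scope classical_set_scope.
Local Open Scope ring_scope.
Context {R : realType} {F : groupType}.
Implicit Types T : cv R F.

(* this relation turns out to be the graph of the isometry *)
Definition same_position T1 T2 (p1 : tree T1) (p2 : tree T2)
    (y : tree T1) (z : tree T2) : Prop :=
  forall h, mdist y (act T1 h p1) = mdist z (act T2 h p2).

(** Place [y] on some [[p1, g p1]] and take [z] at the same distance along [[p2, g p2]]. By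
    [dist_btw] the distances to the orbit are then given by the same formula in both trees. *)
Lemma same_position_ex T1 T2 (p1 : tree T1) (p2 : tree T2) :
  (forall k, disp p1 k = disp p2 k) ->
  forall y, exists z, same_position p1 p2 y z.
Proof.
move=> E y; have [g pyg] := hull p1 y.
have [z [pz zg]] : exists z, mdist p2 z = mdist p1 y /\
    mdist z (act T2 g p2) = disp p2 g - mdist p1 y.
  apply: (tree_point (tree_Rtree T2)); rewrite mdist_ge0 -/(disp p2 g) -E.
  by rewrite /disp -pyg lerDl mdist_ge0.
have pzg : btw p2 z (act T2 g p2) by rewrite /btw zg pz addrC subrK.
exists z => h; rewrite !(metric_sym _ (act _ h _)).
rewrite (dist_btw (tree_Rtree T1) _ pyg) (dist_btw (tree_Rtree T2) _ pzg).
have oE k : mdist (act T1 h p1) (act T1 k p1) = mdist (act T2 h p2) (act T2 k p2).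
  by rewrite !dist_orbit E.
have := oE 1%g; rewrite !act1 => ->; rewrite oE zg (metric_sym z) pz.
rewrite (metric_sym p1); congr (Num.max _ (_ - _)).
by rewrite -E /disp -pyg (metric_sym p1); lra.
Qed.

(** As [y'] lies between two orbit points, its distance to [y] is determined by the distances of [y]
    and [y'] to these. *)
Lemma same_position_dist T1 T2 (p1 : tree T1) (p2 : tree T2) y y' z z' :
  (forall k, disp p1 k = disp p2 k) ->
  same_position p1 p2 y z -> same_position p1 p2 y' z' ->
  mdist y y' = mdist z z'.
Proof.
move=> E yz yz'; have [g pyg] := hull p1 y'.
have e1 : mdist y p1 = mdist z p2 by have := yz 1%g; rewrite !act1.
have e1' : mdist y' p1 = mdist z' p2 by have := yz' 1%g; rewrite !act1.
have pzg : btw p2 z' (act T2 g p2).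
  rewrite /btw (metric_sym p2) -e1' -yz' -/(disp p2 g) -E.
  by rewrite (metric_sym y'); exact: pyg.
rewrite (dist_btw (tree_Rtree T1) _ pyg) (dist_btw (tree_Rtree T2) _ pzg).
by rewrite yz yz' e1 e1'.
Qed.

Lemma same_position_sym T1 T2 (p1 : tree T1) (p2 : tree T2) y z :
  same_position p1 p2 y z -> same_position p2 p1 z y.
Proof. by move=> yz h. Qed.

(** A point is determined by its distances to the orbit. This uniqueness yields equivariance and,
    with the existence lemma for the exchanged trees, surjectivity. *)
Lemma disp_rigid T1 T2 (p1 : tree T1) (p2 : tree T2) :
  (forall k, disp p1 k = disp p2 k) -> cv_eq T1 T2.
Proof.
move=> E; have [f fP] := choice (same_position_ex E).
have iso x y : mdist (f x) (f y) = mdist x y.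
  by rewrite (same_position_dist E (fP x) (fP y)).
have uniq y z : same_position p1 p2 y z -> f y = z.
  move=> yz; apply: mdist_positivity.
  by rewrite -(same_position_dist E (fP y) yz) mdistxx.
exists f; split => //.
- split=> //.
  + move=> x y _ _ fxy; apply: mdist_positivity.
    by rewrite -iso fxy mdistxx.
  + move=> z _.
    have [y /same_position_sym yz] := same_position_ex (fun k => esym (E k)) z.
    by exists y => //; exact: uniq.
- by move=> g x; apply: uniq => h; rewrite !dist_act_l -!actM; exact: fP.
Qed.

End Rigidity.

(** * Words and bounded cancellation *)

Section Words.
Context {N : nat}.
Implicit Types (l : letter N) (u v w : seq (letter N)).

Lemma linvK : involutive (@linv N).
Proof. by case=> i b; rewrite /linv /= negbK. Qed.

Definition invw w := rev (map (@linv N) w).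

Lemma invwK : involutive invw.
Proof.
move=> w; rewrite /invw map_rev revK -map_comp map_id_in // => l _ /=.
by rewrite linvK.
Qed.

Lemma invw_cat u v : invw (u ++ v) = invw v ++ invw u.
Proof. by rewrite /invw map_cat rev_cat. Qed.

Lemma size_invw w : size (invw w) = size w.
Proof. by rewrite size_rev size_map. Qed.

Lemma reduced_invw w : reduced (invw w) = reduced w.
Proof.
rewrite /reduced /invw rev_sorted sorted_map; congr (sorted _ w).
apply/funext => l; apply/funext => l' /=; rewrite linvK.
by rewrite eq_sym.
Qed.

Lemma reduced_catl u v : reduced (u ++ v) -> reduced u.
Proof. by move=> /cat_sorted2[]. Qed.

Lemma reduced_catr u v : reduced (u ++ v) -> reduced v.
Proof. by move=> /cat_sorted2[]. Qed.

Lemma reduced_cat_cons u l v :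
  reduced (u ++ l :: v) = reduced (rcons u l) && reduced (l :: v).
Proof. exact: sorted_cat_cons. Qed.

Lemma reduced_diverge l l' u v : l != l' ->
  reduced (l :: u) -> reduced (l' :: v) -> reduced (invw (l :: u) ++ l' :: v).
Proof.
move=> ll' ru rv; rewrite reduced_cat_cons rv andbT.
rewrite /invw /= rev_cons -!cats1 -catA /= reduced_cat_cons.
apply/andP; split; first by move: ru; rewrite -reduced_invw /invw /= rev_cons.
by rewrite /reduced /= linvK eq_sym ll'.
Qed.

Definition wpow w n := flatten (nseq n w).

Lemma wpowD w m n : wpow w (m + n) = wpow w m ++ wpow w n.
Proof. by rewrite /wpow nseqD flatten_cat. Qed.

Lemma wpowS w n : wpow w n.+1 = w ++ wpow w n.
Proof. by []. Qed.

Lemma size_wpow w n : size (wpow w n) = n * size w.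
Proof. by elim: n => // n IH; rewrite wpowS size_cat IH mulSn. Qed.

Lemma invw_wpow w n : invw (wpow w n) = wpow (invw w) n.
Proof.
elim: n => // n IH; rewrite -addn1 wpowD invw_cat IH addnC wpowD; congr (_ ++ _).
by rewrite /wpow /= !cats0.
Qed.

Lemma nth_wpow l w n i : i < n * size w ->
  nth l (wpow w n) i = nth l w (i %% size w).
Proof.
elim: n i => [|n IH] i; first by rewrite mul0n.
rewrite mulSn wpowS nth_cat => iS.
case: (ltnP i (size w)) => [iw|wi]; first by rewrite modn_small.
by rewrite IH ?ltn_subLR// -[in RHS](subnK wi) modnDr.
Qed.

Lemma reduced_wpow w n : reduced (w ++ w) -> reduced (wpow w n).
Proof.
case: w => [|l w] ww; first by elim: n => // n IH.
elim: n => // -[_|n IH]; first by rewrite wpowS cats0; exact: reduced_catl ww.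
change (reduced ((l :: w) ++ l :: (w ++ wpow (l :: w) n))).
rewrite reduced_cat_cons.
have /andP[-> _] : reduced (rcons (l :: w) l) && reduced (l :: w).
  by rewrite -reduced_cat_cons.
exact: IH.
Qed.

Lemma reduced_nseq n l : reduced (nseq n l).
Proof.
have -> : nseq n l = wpow [:: l] n by elim: n => //= n ->.
apply: reduced_wpow; rewrite /reduced /= andbT.
by case: l => i b; rewrite /linv xpair_eqE eqxx; case: b.
Qed.

(** Strip the first and last letters as long as they are mutually inverse. Being cyclically reduced
    is expressed by [reduced (c ++ c)], which also covers the empty word. *)
Lemma cyclically_reduced_conj w : reduced w ->
  exists u c, w = u ++ c ++ invw u /\ reduced (c ++ c).
Proof.
elim: {w}(size w).+1 {-2}w (ltnSn (size w)) => // n IH [|l w] sw rw.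
  by exists [::], [::].
case: (lastP w) sw rw => [|{}w l'] sw rw.
  exists [::], [:: l]; split=> //=; exact: (reduced_nseq 2 l).
have [E|ne] := eqVneq l (linv l'); last first.
  exists [::], (l :: rcons w l'); split; first by rewrite cats0.
  rewrite reduced_cat_cons rw andbT.
  have -> : rcons (l :: rcons w l') l = (l :: w) ++ [:: l'; l].
    by rewrite -!cats1 /= -catA.
  by rewrite reduced_cat_cons; apply/andP; split=> //; rewrite /reduced /= ne.
have rw' : reduced w.
  have := @reduced_catr [:: l] _ rw; rewrite -cats1; exact: reduced_catl.
have sw' : size w < n by move: sw; rewrite /= size_rcons ltnS => /ltnW.
have [u [c [-> rc]]] := IH w sw' rw'; exists (l :: u), c; split=> //.
by rewrite /invw /= rev_cons -!cats1 E linvK -!catA.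
Qed.

End Words.

(** * Free groups acting on trees: proper orbits and bounded cancellation *)

Section FreeAction.
Local Open Scope classical_set_scope.
Local Open Scope ring_scope.
Context {R : realType} {N : nat} {F : groupType} {a : 'I_N -> F}.
Hypothesis ha : free_basis a.
Implicit Types (l : letter N) (u v w : seq (letter N)) (g h k : F).
Local Notation val := (word_val a).

Lemma val_cat u v : val (u ++ v) = (val u * val v)%g.
Proof. exact: big_cat. Qed.

Lemma val_nil : val [::] = 1%g. Proof. exact: big_nil. Qed.

Lemma val_cons l w : val (l :: w) = (letter_val a l * val w)%g.
Proof. exact: big_cons. Qed.

Lemma letter_valV l : letter_val a (linv l) = (letter_val a l)^-1%g.
Proof. by case: l => i []; rewrite /letter_val //= invgK. Qed.

Lemma val_invw w : val (invw w) = (val w)^-1%g.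
Proof.
elim: w => [|l w IH]; first by rewrite val_nil invg1.
rewrite /invw /= rev_cons -cats1 val_cat IH !val_cons val_nil mulg1 letter_valV.
by rewrite invgM.
Qed.

Lemma val_wpow w n : val (wpow w n) = (val w ^+ n)%g.
Proof. by elim: n => [|n IH]; rewrite ?val_nil// wpowS val_cat IH expgS. Qed.

Lemma val_reduced_inj u v : reduced u -> reduced v -> val u = val v -> u = v.
Proof.
move=> ru rv uv; have [w [_ wu]] := ha (val u).
by rewrite -(wu u)// -(wu v).
Qed.

Lemma val_reduced_ex g : exists2 w, reduced w & val w = g.
Proof. by have [w [[]]] := ha g; exists w. Qed.

(** Word length at most [n]. The witness may be unreduced, so that products are handled by
    concatenation. *)
Definition short n g := exists2 w, (size w <= n)%N & val w = g.

Lemma short_leq m n g : (m <= n)%N -> short m g -> short n g.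
Proof. by move=> mn [w wm <-]; exists w => //; exact: leq_trans mn. Qed.

Lemma short_mul m n g h : short m g -> short n h -> short (m + n)%N (g * h)%g.
Proof.
move=> [u um <-] [v vn <-]; exists (u ++ v); last exact: val_cat.
by rewrite size_cat leq_add.
Qed.

Lemma short_ex g : exists n, short n g.
Proof. by have [w _ <-] := val_reduced_ex g; exists (size w), w. Qed.

(** Free reduction, carried out letter by letter from the right, never lengthens a word, and the
    reduced form is unique. *)
Lemma short_reduced n w : reduced w -> short n (val w) -> (size w <= n)%N.
Proof.
move=> rw [v vn vw].
suff [v' rv' [sv' vv']] : exists2 v', reduced v' &
    (size v' <= size v)%N /\ val v' = val v.
  by rewrite (val_reduced_inj rw rv') ?vv'//; exact: leq_trans vn.
elim: {n w rw vn vw} v => [|l v [v' rv' [sv' vv']]]; first by exists [::].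
case: v' => [|l' v'] in rv' sv' vv' *.
  by exists [:: l] => //; rewrite !val_cons -vv'.
have [E|ne] := eqVneq l' (linv l).
  exists v'; first exact: (@reduced_catr _ [:: l']) rv'.
  split; first by rewrite ltnW// ltnW.
  by rewrite val_cons -vv' val_cons E letter_valV mulVKg.
exists (l :: l' :: v'); first by rewrite /reduced /= ne.
by split=> //; rewrite !(val_cons l) -vv'.
Qed.

Context (T : cv R F).
Implicit Types (x y z p q : tree T).
Local Notation d := (@mdist R (tree T)).
Local Notation treeT := (tree_Rtree T).

Lemma letters_bound x : exists2 B, 0 <= B & forall l, disp x (letter_val a l) <= B.
Proof.
(* The sum over the finitely many letters is a crude substitute for the maximum. *)
exists (\sum_(l : 'I_N * bool) disp x (letter_val a l)).
  by apply: sumr_ge0 => l _; exact: disp_ge0.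
move=> l; rewrite (bigD1 l)//= lerDl.
by apply: sumr_ge0 => l' _; exact: disp_ge0.
Qed.

Lemma btw_path (P : nat -> tree T) n q : btw (P 0%N) q (P n) ->
  q = P 0%N \/ exists2 i, (i < n)%N & btw (P i) q (P i.+1).
Proof.
elim: n => [|n IH] Pq.
  left; apply: mdist_positivity; rewrite metric_sym.
  by have := mdist_ge0 q (P 0%N); move: Pq; rewrite /btw mdistxx metric_sym; lra.
have [/IH[->|[i iN Pi]]|Pn] := btw_split treeT (P n) Pq; first by left.
  by right; exists i => //; exact: ltnW.
by right; exists n.
Qed.

Lemma btw_word x w q : btw x q (act T (val w) x) ->
  q = x \/ exists u l v, w = u ++ l :: v /\
    btw (act T (val u) x) q (act T (val u) (act T (letter_val a l) x)).
Proof.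
move=> xq; have [] := @btw_path (fun i => act T (val (take i w)) x) (size w) q.
- by rewrite take0 val_nil act1 take_size.
- by rewrite take0 val_nil act1; left.
case=> i iw p; right; case: w => [//|l0 w'] in xq iw p *.
set w := l0 :: w' in xq iw p *.
exists (take i w), (nth l0 w i), (drop i.+1 w); split.
  by rewrite -drop_nth// cat_take_drop.
move: p; rewrite (take_nth l0)// -cats1 val_cat val_cons val_nil mulg1.
by rewrite actM.
Qed.

Lemma near_prefix x B w q : 0 <= B -> (forall l, disp x (letter_val a l) <= B) ->
  btw x q (act T (val w) x) ->
  exists2 i, (i <= size w)%N & d q (act T (val (take i w)) x) <= B.
Proof.
move=> B0 hB /btw_word[->|[u [l [v [-> uq]]]]].
  by exists 0%N => //; rewrite take0 val_nil act1 mdistxx.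
exists (size u); first by rewrite size_cat leq_addr.
rewrite take_size_cat//; apply: le_trans (hB l).
move: uq; rewrite /btw act_isometry metric_sym -/(disp x (letter_val a l)) => <-.
by rewrite lerDl mdist_ge0.
Qed.

(** Cocompactness: the segments [[x, l x]], one for each letter [l], have translates that cover the
    tree. It comes from minimality through [hull]. *)
Lemma cover_word x q : exists g, d q (act T g x) = 0 \/
  exists l, btw x (act T g q) (act T (letter_val a l) x).
Proof.
have [g] := hull x q; have [w _ <-] := val_reduced_ex g.
case/btw_word => [->|[u [l [v [_ uq]]]]].
  by exists 1%g; left; rewrite act1 mdistxx.
exists (val u)^-1%g; right; exists l; move: uq; rewrite /btw.
have tr y z : d (act T (val u) y) z = d y (act T (val u)^-1%g z) := dist_act_l _ _ _.
by rewrite act_isometry tr (metric_sym q) tr (metric_sym (act T (letter_val a l) x)).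
Qed.

(** A compactness argument in the form of a supremum: [sg] bounds the lengths [s] of initial parts
    of [[x, y]] on which the displacements are uniformly bounded below. Discreteness at the point
    [c] at distance [sg] extends such a bound past [c]. *)
Lemma segment_discrete x y : exists2 e, 0 < e &
  forall q g, btw x q y -> g <> 1%g -> e <= disp q g.
Proof.
have disc (c : tree T) : exists2 e, 0 < e & forall g, g <> 1%g -> e <= disp c g.
  have [e e0 H] := act_discrete c; exists e => // g g1.
  by rewrite leNgt; apply/negP => /H/(@act_free _ _ T).
pose S : set R := [set s | 0 <= s <= d x y /\ exists2 e, 0 < e &
  forall q g, btw x q y -> d x q <= s -> g <> 1%g -> e <= disp q g].
have d0 := mdist_ge0 x y.
have S0 : S 0.
  split; first by rewrite lexx.
  have [e e0 H] := disc x; exists e => // q g _ xq /H.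
  suff -> : q = x by [].
  by apply/esym/mdist_positivity/eqP; rewrite eq_le xq mdist_ge0.
have supS : has_sup S.
  by split; [exists 0|exists (d x y) => s [/andP[]]].
set sg := sup S.
have sg_ub s : S s -> s <= sg by move=> Ss; apply: ub_le_sup => //; exact: supS.2.
have sg0 : 0 <= sg by exact: sg_ub.
have sgd : sg <= d x y by apply: ge_sup; [exact: supS.1|move=> s [/andP[]]].
have [c [xc cy]] : exists w : tree T, d x w = sg /\ d w y = d x y - sg.
  by apply: (tree_point treeT); rewrite sg0.
have xcy : btw x c y by rewrite /btw xc cy; lra.
have [e e0 He] := disc c.
have e4 : 0 < e / 4 by lra.
have [s [/andP[s0 sd] [e' e'0 He']] sgs] := sup_adherent e4 supS.
rewrite -/sg in sgs.
pose m := Num.min e' (e / 2).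
have m0 : 0 < m by rewrite lt_min e'0; lra.
(* Points within [e / 4] of [c] have displacement at least [e - 2 * (e / 4)], which is the [e / 2]
   in [m]. *)
have key q g : btw x q y -> d x q <= sg + e / 4 -> g <> 1%g -> m <= disp q g.
  move=> xqy xq g1; rewrite ge_min.
  have [qs|sq] := leP (d x q) s; first by rewrite He'.
  apply/orP; right.
  have qc : d q c <= e / 4.
    rewrite (dist_btw treeT q xcy) !(metric_sym _ x) xc cy ge_max.
    by move: xqy; rewrite /btw => xqy; apply/andP; split; lra.
  have := He g g1; rewrite /disp.
  have := triangle_via q c (act T g c).
  have := triangle_via (act T g q) q (act T g c).
  rewrite act_isometry (metric_sym c q); lra.
exists m => // q g xqy; apply: (key) => //.
suff -> : sg = d x y by move: xqy; rewrite /btw; have := mdist_ge0 q y; lra.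
apply/eqP; rewrite eq_le sgd /= leNgt; apply/negP => lt.
pose s' := Num.min (sg + e / 4) (d x y).
have : s' <= sg.
  apply: sg_ub; split; first by rewrite /s' le_min ge_min lexx orbT d0 !andbT; lra.
  exists m => // q' g' b' le'; apply: key => //; apply: (le_trans le').
  by rewrite /s' ge_min lexx.
by rewrite /s' leNgt lt_min lt andbT; lra.
Qed.

(** By [disp_act], translating a point amounts to conjugating the group element, so it suffices to
    treat the finitely many segments of [cover_word]. *)
Lemma uniformly_discrete : exists2 e, 0 < e &
  forall (q : tree T) g, g <> 1%g -> e <= disp q g.
Proof.
have [x _] := tree_neq0 T.
have disc (l : 'I_N * bool) : exists e, 0 < e /\ forall q g,
    btw x q (act T (letter_val a l) x) -> g <> 1%g -> e <= disp q g.
  by have [e e0 H] := segment_discrete x (act T (letter_val a l) x); exists e.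
have [e eP] := choice disc.
have [ex ex0 exP] := segment_discrete x x.
have [e1 e10 e1P] : exists2 e1, 0 < e1 & forall l, e1 <= e l.
  suff [e1 e10 H] : exists2 e1, 0 < e1 &
      forall l, l \in enum {: 'I_N * bool} -> e1 <= e l.
    by exists e1 => // l; apply: H; rewrite mem_enum.
  elim: (enum _) => [|l s [e1 e10 IH]]; first by exists 1.
  exists (Num.min (e l) e1); first by rewrite lt_min e10 andbT (eP l).1.
  move=> l'; rewrite inE => /orP[/eqP->|/IH le1]; first by rewrite ge_min lexx.
  by rewrite ge_min le1 orbT.
exists (Num.min ex e1); first by rewrite lt_min ex0.
move=> q g g1; have [h [/mdist_positivity ->|[l xl]]] := cover_word x q.
  rewrite disp_act ge_min exP//; first by rewrite /btw mdistxx addr0.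
  move=> /(congr1 (fun k => h * k * h^-1)%g).
  by rewrite mulg1 mulgV -!mulgA mulgV mulg1 mulVKg.
have := (eP l).2 _ (h * g * h^-1)%g xl.
rewrite disp_act -!mulgA mulVg mulg1 mulKg ge_min => H.
apply/orP; right; apply: le_trans (e1P l) (H _) => E; apply: g1.
move: E => /(congr1 (fun k => h^-1 * k * h)%g).
by rewrite mulg1 mulVg -!mulgA mulVg mulg1 mulKg.
Qed.

Lemma segment_net x y (delta : R) M : 0 < delta -> d x y <= M%:R * delta ->
  exists z : 'I_M.+1 -> tree T, forall q, btw x q y -> exists j, d q (z j) <= delta.
Proof.
move=> d0 dM.
have [z zP] : exists z : 'I_M.+1 -> tree T, forall j : 'I_M.+1,
    j%:R * delta <= d x y -> btw x (z j) y /\ d x (z j) = j%:R * delta.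
  suff /choice[z zP] : forall j : 'I_M.+1, exists w : tree T, j%:R * delta <= d x y ->
      btw x w y /\ d x w = j%:R * delta by exists z.
  move=> j; have [jd|_] := leP (j%:R * delta) (d x y); last by exists x.
  have [|w [xw wy]] := @tree_point _ _ treeT x y (j%:R * delta).
    by rewrite jd mulr_ge0// ltW.
  by exists w => _; rewrite /btw xw wy addrC subrK.
exists z => q xqy.
have q0 : 0 <= d x q / delta by rewrite divr_ge0 ?mdist_ge0// ltW.
have /andP[jl jr] := truncn_itv q0; set j := Num.truncn _ in jl jr.
rewrite ler_pdivlMr// in jl; rewrite ltr_pdivrMr// in jr.
have qd : d x q <= d x y by move: xqy; rewrite /btw => <-; rewrite lerDl mdist_ge0.
have jM : (j < M.+1)%N.
  have := le_trans (le_trans jl qd) dM.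
  by rewrite ler_pM2r// ler_nat.
have [zb xz] := zP (Ordinal jM) (le_trans jl qd).
exists (Ordinal jM); rewrite (dist_btw treeT q zb) !(metric_sym _ x) xz.
have zy : d (z (Ordinal jM)) y = d x y - j%:R * delta.
  by move: zb; rewrite /btw xz /=; lra.
rewrite zy ge_max /=; move: xqy; rewrite /btw -natr1 in jr *.
by move=> xqy; apply/andP; split; lra.
Qed.

Lemma orbit_net (delta : R) : 0 < delta ->
  exists (I : finType) (z : I -> tree T),
    forall y, exists g i, d y (act T g (z i)) <= delta.
Proof.
move=> d0; have [x _] := tree_neq0 T.
have [B B0 hB] := letters_bound x.
pose M := (Num.truncn (B / delta)).+1.
have BM : B <= M%:R * delta.
  have /andP[_] := @truncn_itv R (B / delta) (divr_ge0 B0 (ltW d0)).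
  by rewrite ltr_pdivrMr// => /ltW.
have net (l : 'I_N * bool) := @segment_net x (act T (letter_val a l) x) delta M d0
  (le_trans (hB l) BM).
have [z zP] := choice net.
exists (option ('I_N * bool * 'I_M.+1)%type),
  (fun i => if i is Some lj then z lj.1 lj.2 else x).
move=> y; have [g [/mdist_positivity->|[l /(zP l)[j yj]]]] := cover_word x y.
  by exists g, None; rewrite mdistxx ltW.
exists g^-1%g, (Some (l, j)) => /=.
by rewrite metric_sym dist_act_l invgK metric_sym.
Qed.

(* the Milnor-Svarc argument *)
Lemma proper_orbit x (r : R) :
  exists K, forall w, reduced w -> disp x (val w) <= r -> (size w <= K)%N.
Proof.
have [e e0 disc] := uniformly_discrete.
have e8 : 0 < e / 8 by lra.
have [I [z zP]] := orbit_net e8.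
(* For each pair of net points at most one [g] brings them closer than [e / 2], since two such
   elements would differ by one of displacement below [e]. So its word length bounds all cases. *)
have [K KP] : exists K : I * I -> nat, forall ij g,
    d (z ij.1) (act T g (z ij.2)) < e / 2 -> short (K ij) g.
  suff /choice[K KP] : forall ij : I * I, exists n, forall g,
      d (z ij.1) (act T g (z ij.2)) < e / 2 -> short n g by exists K.
  move=> [i j] /=.
  have [[g0 dg0]|none] := pselect (exists g, d (z i) (act T g (z j)) < e / 2).
    have [n sn] := short_ex g0; exists n => g dg.
    suff -> : g = g0 by [].
    apply: contrapT => gg0.
    have /disc : (g^-1 * g0)%g <> 1%g.
      by move=> /(congr1 (fun k => g * k)%g); rewrite mulg1 mulVKg => /esym.
    move=> /(_ (z j)); rewrite -dist_orbit leNgt => /negP; apply.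
    have := triangle_via (z i) (act T g (z j)) (act T g0 (z j)).
    rewrite (metric_sym _ (z i)); lra.
  by exists 0%N => g dg; case: none; exists g.
pose K0 := (\sum_ij K ij)%N.
have K0P i j g : d (z i) (act T g (z j)) < e / 2 -> short K0 g.
  move=> /(KP (i, j)); apply: short_leq.
  by rewrite /K0 (bigD1 (i, j))//= leq_addr.
(* Go [e / 4] along the segment and pass to a net point within [e / 8]: this costs one element of
   length at most [K0] and shortens the remaining distance by at least [e / 8]. *)
have step n : forall i j g,
    d (z i) (act T g (z j)) < e / 2 + n%:R * (e / 8) -> short (n.+1 * K0)%N g.
  elim: n => [|n IH] i j g; first by rewrite mul0r addr0 mul1n; exact: K0P.
  have [/K0P sg _|le lt] := ltP (d (z i) (act T g (z j))) (e / 2).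
    by apply: short_leq sg; rewrite mulSn leq_addr.
  have [y [iy yj]] := @tree_point _ _ treeT (z i) (act T g (z j)) (e / 4) ltac:(lra).
  have [h [k yk]] := zP y.
  have /K0P sh : d (z i) (act T h (z k)) < e / 2.
    by have := triangle_via y (z i) (act T h (z k)); lra.
  have /IH sg : d (z k) (act T (h^-1 * g)%g (z j)) < e / 2 + n%:R * (e / 8).
    rewrite actM -dist_act_l -natr1 in lt *.
    have := triangle_via y (act T h (z k)) (act T g (z j)).
    rewrite (metric_sym _ y); lra.
  by rewrite -(mulVKg h g) mulSn; exact: short_mul.
have [h [i xi]] := zP x.
have [m1 s1] := short_ex h; have [m2 s2] := short_ex h^-1%g.
pose n := (Num.truncn (r / (e / 8))).+1.
have rn : r < n%:R * (e / 8).
  have [r0|r0] := leP 0 r; last by apply: (lt_trans r0); rewrite mulr_gt0.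
  have /andP[_] := @truncn_itv R (r / (e / 8)) (divr_ge0 r0 (ltW e8)).
  by rewrite ltr_pdivrMr.
exists (m1 + n.+1 * K0 + m2)%N => w rw xw; apply: short_reduced => //.
have : short (n.+1 * K0)%N (h^-1 * val w * h)%g.
  apply: (step n i i).
  rewrite -mulgA actM -dist_act_l actM.
  have := triangle_via x (act T h (z i)) (act T (val w) (act T h (z i))).
  have := triangle_via (act T (val w) x) x (act T (val w) (act T h (z i))).
  rewrite act_isometry (metric_sym _ x) -/(disp x _); lra.
move=> /(short_mul s1) /short_mul /(_ s2).
by rewrite -!mulgA mulgV mulg1 mulVKg.
Qed.

Lemma proper_orbit_lt x (r : R) :
  exists K, forall w, reduced w -> (K < size w)%N -> r < disp x (val w).
Proof.
have [K KP] := proper_orbit x r; exists K => w rw Kw.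
by rewrite ltNge; apply/negP => /(KP w rw); rewrite leqNgt Kw.
Qed.

(** Let [q] be the point where the segments to [u x] and [v x] part. It is within [B] of the images
    of [x] under a prefix of [u] and a prefix of [v]. The quotient of these prefixes is a reduced
    word of displacement at most [2 * B], so properness bounds the prefix of [u] by [K] letters, and
    with it the distance of [q] from [x]. *)
Lemma bounded_cancellation x : exists2 C, 0 <= C &
  forall u v, reduced (invw u ++ v) -> turn x (val u) (val v) <= C.
Proof.
have [B B0 hB] := letters_bound x; have [K KP] := proper_orbit x (2 * B).
exists (B + K%:R * B); first by rewrite addr_ge0// mulr_ge0.
move=> u v ruv; set t := turn _ _ _.
have [q [xq qu]] : exists q, d x q = t /\ d q (act T (val u) x) = disp x (val u) - t.
  by apply: (tree_point treeT); rewrite turn_ge0 gromov_lel.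
have bu : btw x q (act T (val u) x) by rewrite /btw xq qu /disp; lra.
have bv : btw x q (act T (val v) x).
  have := dist_btw treeT (act T (val v) x) bu.
  rewrite !(metric_sym _ x) xq qu (metric_sym _ q) -/(disp x (val v)).
  have -> : mdist (act T (val v) x) (act T (val u) x) - (disp x (val u) - t) =
            disp x (val v) - t.
    by rewrite metric_sym /t /turn /gromov /disp; lra.
  by rewrite maxxx /btw xq => ->; rewrite /disp; lra.
have [i iu qi] := near_prefix B0 hB bu; have [j jv qj] := near_prefix B0 hB bv.
have rij : reduced (invw (take i u) ++ take j v).
  move: ruv; rewrite -{1}(cat_take_drop i u) -{1}(cat_take_drop j v) invw_cat.
  by rewrite -catA => /reduced_catr; rewrite catA => /reduced_catl.
have /(KP _ rij) : disp x (val (invw (take i u) ++ take j v)) <= 2 * B.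
  rewrite val_cat val_invw -dist_orbit.
  have := triangle_via q (act T (val (take i u)) x) (act T (val (take j v)) x).
  rewrite (metric_sym _ q); lra.
rewrite size_cat size_invw size_takel// => /(leq_trans (leq_addr _ _)) iK.
have xi : disp x (val (take i u)) <= K%:R * B.
  have disp_word w : disp x (val w) <= (size w)%:R * B.
    elim: w => [|l w IH]; first by rewrite val_nil disp1 mul0r.
    rewrite val_cons /= -natr1 disp_mul; have := hB l.
    have := turn_ge0 x (letter_val a l)^-1%g (val w); lra.
  apply: le_trans (disp_word _) _; rewrite size_takel//.
  by rewrite ler_wpM2r// ler_nat.
have := triangle_via (act T (val (take i u)) x) x q; rewrite xq -/(disp x _).
rewrite (metric_sym _ q); lra.
Qed.

(** Removing a common first letter moves the base point by at most [B]; once the first letters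
    differ, bounded cancellation applies. *)
Lemma turn_diverge x : exists2 C, 0 <= C &
  forall i l0 u v, reduced u -> reduced v -> (i < size u)%N -> (i < size v)%N ->
    nth l0 u i != nth l0 v i -> turn x (val u) (val v) <= i.+1%:R * C.
Proof.
have [B B0 hB] := letters_bound x; have [C C0 hC] := bounded_cancellation x.
exists (B + C); first exact: addr_ge0.
move=> i l0; elim: i => [|i IH] [|l u] [|l' v] //= ru rv iu iv uv.
  by rewrite mul1r ler_wpDl// hC// reduced_diverge.
have [E|ll'] := eqVneq l l'; last first.
  rewrite -natr1 mulrDl mul1r ler_wpDl//; last first.
    by rewrite ler_wpDl// hC// reduced_diverge.
  by rewrite mulr_ge0// addr_ge0.
rewrite -E in rv uv *.
have {}ru := @reduced_catr _ [:: l] _ ru; have {}rv := @reduced_catr _ [:: l] _ rv.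
have := IH _ _ ru rv iu iv uv; have := hB l.
have := gromov_base x (act T (letter_val a l) x) (act T (val (l :: u)) x)
  (act T (val (l :: v)) x).
rewrite -/(turn _ _ _) -/(disp x _).
have -> : gromov (act T (letter_val a l) x) (act T (val (l :: u)) x)
    (act T (val (l :: v)) x) = turn x (val u) (val v).
  by rewrite !val_cons !actM /turn /gromov !act_isometry.
rewrite -(natr1 i.+1); lra.
Qed.

End FreeAction.

(** * Words occurring in a random trajectory *)

Section Occurrences.
Local Open Scope classical_set_scope.
Local Open Scope ring_scope.
Context {R : realType} {N : nat} {hN : (1 < N)%N}.
Implicit Types (xi : boundary hN) (u v w : seq (letter N)).

Lemma initial_wordD xi m n :
  initial_word xi (m + n) = initial_word xi m ++ mkseq (fun i => xi (m + i)%N) n.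
Proof.
rewrite /initial_word /mkseq iotaD map_cat add0n; congr (_ ++ _).
by rewrite -[m in iota m n]addn0 iotaDl -map_comp.
Qed.

Lemma size_initial_word xi n : size (initial_word xi n) = n.
Proof. exact: size_mkseq. Qed.

Lemma initial_word_catl xi u v :
  initial_word xi (size u + size v) = u ++ v -> initial_word xi (size u) = u.
Proof.
rewrite initial_wordD => /eqP; rewrite eqseq_cat ?size_initial_word//.
by move=> /andP[/eqP].
Qed.

Lemma nth_initial_word l xi i n : (i < n)%N -> nth l (initial_word xi n) i = xi i.
Proof. by move=> lt_in; rewrite nth_mkseq. Qed.

Lemma reduced_initial_word xi n : reduced (initial_word xi n).
Proof.
apply/(sortedP (xi 0%N)) => i; rewrite size_initial_word => iN.
by rewrite !nth_initial_word ?(ltnW iN)//; exact: traj_reduced.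
Qed.

Definition occurs v xi :=
  exists i, initial_word xi (i + size v) = initial_word xi i ++ v.

Lemma occurs_bigcup v : [set xi | occurs v xi] = \bigcup_w cylinder hN (w ++ v).
Proof.
apply/seteqP; split=> xi.
  case=> i E; exists (initial_word xi i) => //.
  by rewrite /cylinder /= size_cat size_initial_word.
case=> w _; rewrite /cylinder /= size_cat => E; exists (size w).
by rewrite E (initial_word_catl E).
Qed.

Lemma open_cylinder v : open (cylinder hN v).
Proof.
have -> : cylinder hN v =
    \bigcup_(i in [set i : nat * boundary hN | initial_word i.2 i.1 = v])
      cylinder hN (initial_word i.2 i.1).
  apply/seteqP; split=> xi; last by case=> i /= ->.
  by move=> E; exists (size v, xi) => //=; rewrite E.
by exists [set i : nat * boundary hN | initial_word i.2 i.1 = v].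
Qed.

Lemma measurable_cylinder v : measurable (cylinder hN v : set (borel_boundary hN)).
Proof. by apply: sub_sigma_algebra; exact: open_cylinder. Qed.

Lemma measurable_occurs v :
  measurable ([set xi | occurs v xi] : set (borel_boundary hN)).
Proof.
apply: sub_sigma_algebra; rewrite /= occurs_bigcup.
by apply: bigcup_open => w _; exact: open_cylinder.
Qed.

Lemma cylinder_nonreduced v : ~~ reduced v -> cylinder hN v = set0.
Proof.
move=> rv; rewrite -subset0 => xi; rewrite /cylinder /= => E.
by move: rv; rewrite -E reduced_initial_word.
Qed.

Lemma cylinder_catl u v : cylinder hN (u ++ v) `<=` cylinder hN u.
Proof.
by move=> xi; rewrite /cylinder /= size_cat => /initial_word_catl.
Qed.

Lemma cylinder_split u b :
  cylinder hN u = \bigcup_(t : b.-tuple ('I_N * bool)) cylinder hN (u ++ t).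
Proof.
apply/seteqP; split=> xi; last by case=> t _; exact: cylinder_catl.
rewrite /cylinder /= => E.
have st : size (mkseq (fun i => xi (size u + i)%N) b) == b by rewrite size_mkseq.
exists (Tuple st) => //=.
by rewrite size_cat size_mkseq initial_wordD E.
Qed.

Lemma trivIset_cylinder u b (D : set (b.-tuple ('I_N * bool))) :
  trivIset D (fun t : b.-tuple ('I_N * bool) => cylinder hN (u ++ t)).
Proof.
move=> s t _ _ [xi []]; rewrite /cylinder /= !size_cat !size_tuple => -> /eqP.
by rewrite eqseq_cat// eqxx /= => /eqP/val_inj.
Qed.

Lemma letter_avoid (l1 l2 : letter N) : exists c : letter N, c != l1 /\ c != l2.
Proof.
pose o0 := Ordinal (ltnW hN); pose o1 := Ordinal hN.
have [E0|E0] := eqVneq (o0, true) l1.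
  have [E1|E1] := eqVneq (o0, false) l2.
    by exists (o1, true); rewrite -E0 -E1.
  by exists (o0, false); rewrite -E0.
have [E2|E2] := eqVneq (o0, true) l2; last by exists (o0, true).
have [E1|E1] := eqVneq (o0, false) l1.
  by exists (o1, true); rewrite -E2 -E1.
by exists (o0, false); rewrite -E2.
Qed.

Lemma reduced_connect u v : reduced u -> reduced v ->
  exists c, reduced (u ++ c :: v).
Proof.
move=> ru rv.
(* The default letter stands in for the missing end of an empty word and only adds a harmless
   constraint on [c]. *)
have [c [cu cv]] := letter_avoid (linv (last (Ordinal hN, true) u))
  (linv (head (Ordinal hN, true) v)).
exists c; rewrite reduced_cat_cons; apply/andP; split.
  case: (lastP u) ru cu => [|u' l] //= ru; rewrite last_rcons => cu.
  have -> : rcons (rcons u' l) c = u' ++ [:: l; c] by rewrite -!cats1 -catA.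
  by rewrite reduced_cat_cons ru /reduced /= cu.
case: v rv cv => [|l v] //= rv cv.
by rewrite rv andbT; apply: contra cv => /eqP ->; rewrite linvK.
Qed.

Context (m : probability (borel_boundary hN) R).
Hypothesis hm : uniform_measure m.

Lemma measure_cylinder_cat u t : u != [::] -> reduced (u ++ t) ->
  m (cylinder hN (u ++ t)) =
    ((((2 * N - 1) ^ size t)%N%:R^-1)%:E * m (cylinder hN u))%E.
Proof.
move=> u0 rut; rewrite !hm//; last 2 first.
- exact: reduced_catl rut.
- by case: u u0 {rut}.
rewrite -EFinM -invfM -natrM; congr (_%:R^-1)%:E.
case: u u0 {rut} => //= l u _; rewrite size_cat expnD.
by rewrite mulnA mulnC.
Qed.

(** Read the trajectory after [u] in blocks of [(size v).+1] letters. Whatever came before, a block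
    consists of a suitable connecting letter followed by [v] with conditional probability [eps], so
    each further block costs a factor [1 - eps]. *)
Lemma measure_avoid v u k : reduced v -> u != [::] ->
  (m (cylinder hN u `&` ~` [set xi | occurs v xi]) <=
   ((1 - ((2 * N - 1) ^ (size v).+1)%N%:R^-1) ^+ k)%:E * m (cylinder hN u))%E.
Proof.
move=> rv; set Z : set (borel_boundary hN) := ~` _.
set b := (size v).+1; set eps := _%:R^-1.
have p1 : (0 < (2 * N - 1) ^ b)%N by rewrite expn_gt0 subn_gt0 (leq_trans hN)// leq_pmull.
have eps1 : 0 <= 1 - eps by rewrite subr_ge0 invf_le1 ?ler1n// ltr0n.
have mZ : measurable Z by apply: measurableC; exact: measurable_occurs.
have mc w : measurable (cylinder hN w : set (borel_boundary hN)) := measurable_cylinder w.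
elim: k u => [|k IH] u u0.
  rewrite expr0 mul1e; apply: le_measure; last exact: subIsetl.
  - by rewrite inE; exact: measurableI.
  - by rewrite inE.
have [ru|nru] := boolP (reduced u); last first.
  by rewrite cylinder_nonreduced// set0I measure0 mule0.
have [c rc] := reduced_connect ru rv.
pose t0 : b.-tuple ('I_N * bool) := [tuple of c :: (in_tuple v)].
pose D : set (b.-tuple ('I_N * bool)) := [set t | t != t0].
have finD : finite_set D by exact: finite_finset.
have t0Z : cylinder hN (u ++ t0) `&` Z = set0.
  have E : u ++ t0 = (u ++ [:: c]) ++ v by rewrite -catA.
  rewrite -subset0 E => xi [xit] [].
  have : (\bigcup_w cylinder hN (w ++ v)) xi by exists (u ++ [:: c]).
  by rewrite -occurs_bigcup.
have cover : cylinder hN u `&` Z `<=` \bigcup_(t in D) (cylinder hN (u ++ t) `&` Z).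
  move=> xi [+ Zxi]; rewrite (cylinder_split u b) => -[t _ xit].
  exists t => //; apply/eqP => tt0; rewrite tt0 in xit.
  by rewrite -[False]/(set0 xi) -t0Z.
have le1 := @content_sub_fsum _ _ _ m _ D (cylinder hN u `&` Z)
  (fun t : b.-tuple ('I_N * bool) => cylinder hN (u ++ t) `&` Z) finD.
apply: (le_trans (le1 _ _ cover)).
- by move=> t _; exact: measurableI.
- exact: measurableI.
apply: (@le_trans _ _ (\sum_(t \in D) ((1 - eps) ^+ k)%:E * m (cylinder hN (u ++ t)))%E).
  apply: lee_fsum => // t _; apply: IH; by case: (u) u0.
rewrite -ge0_mule_fsumr//.
rewrite exprSr EFinM -muleA; apply: lee_pmul => //.
- by rewrite lee_fin exprn_ge0.
- by apply: fsume_ge0 => t _; exact: measure_ge0.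
rewrite -measure_fin_bigcup//; last exact: trivIset_cylinder.
(* The blocks other than [t0] fill at most the complement of the cylinder of [u ++ t0], whose
   measure is [1 - eps] times that of the cylinder of [u]. *)
have sub : \bigcup_(t in D) cylinder hN (u ++ t) `<=`
    cylinder hN u `\` cylinder hN (u ++ t0).
  move=> xi [t Dt xit]; split; first exact: cylinder_catl xit.
  move=> xit0; move/eqP: Dt; apply.
  by apply: (@trivIset_cylinder u b setT) => //; exists xi.
apply: (@le_trans _ _ (m (cylinder hN u `\` cylinder hN (u ++ t0)))).
  apply: le_measure => //; rewrite inE; last exact: measurableD.
  by apply: fin_bigcup_measurable.
have -> : m (cylinder hN u `\` cylinder hN (u ++ t0)) =
    (m (cylinder hN u) - m (cylinder hN (u ++ t0)))%E.
  have fin : (m (cylinder hN u) < +oo)%E.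
    exact: le_lt_trans (probability_le1 m (mc u)) (ltry 1).
  have := measureD (mc u) (mc (u ++ t0)) fin.
  by rewrite (setIidr (@cylinder_catl _ _)).
rewrite measure_cylinder_cat//= -/b.
by rewrite hm// -/eps -EFinM -EFinB -EFinM lee_fin mulrBl mul1r.
Qed.

(** Let the number of blocks tend to infinity on each one-letter cylinder. These finitely many
    cylinders cover the boundary and meet the condition that [u] be nonempty. *)
Lemma negligible_avoid v : reduced v -> m.-negligible (~` [set xi | occurs v xi]).
Proof.
move=> rv; set Z : set (borel_boundary hN) := ~` _.
have mZ : measurable Z by apply: measurableC; exact: measurable_occurs.
have mc w : measurable (cylinder hN w : set (borel_boundary hN)) := measurable_cylinder w.
have null u : u != [::] -> m (cylinder hN u `&` Z) = 0%E.
  move=> u0; apply/eqP; rewrite -measure_le0; apply/lee_addgt0Pr => e e0.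
  rewrite add0e.
  have := fun k => @measure_avoid v u k rv u0.
  set r := 1 - _ => H.
  have p1 : (1 < (2 * N - 1) ^ (size v).+1)%N.
    by rewrite -{1}(exp1n (size v).+1) ltn_exp2r//; lia.
  have r1 : `|r| < 1.
    have i1 : ((2 * N - 1) ^ (size v).+1)%N%:R^-1 < 1 :> R.
      by rewrite invf_lt1 ?ltr1n// ltr0n ltnW.
    have i0 : 0 < ((2 * N - 1) ^ (size v).+1)%N%:R^-1 :> R.
      by rewrite invr_gt0 ltr0n ltnW.
    by rewrite /r ger0_norm; lra.
  have /cvgr0_norm_lt/(_ _ e0)[k _ kP] := cvg_expr r1.
  apply: le_trans (H k) _.
  apply: (@le_trans _ _ (r ^+ k)%:E).
    rewrite -[leRHS]mule1; apply: lee_pmul => //; last exact: probability_le1.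
    rewrite lee_fin exprn_ge0//; have := ler_norm r; have := r1.
    rewrite /r subr_ge0 invf_le1 ?ler1n ?ltr0n// ltnW//; exact: ltnW.
  rewrite lee_fin; apply: le_trans (ler_norm _) (ltW (kP k _)) => //=.
apply/negligibleP => //; apply/eqP; rewrite -measure_le0.
have cover : Z `<=` \bigcup_(l in [set: 'I_N * bool]) (cylinder hN [:: l] `&` Z).
  by move=> xi Zxi; exists (xi 0%N) => //; split.
have finT : finite_set [set: 'I_N * bool] by exact: finite_finset.
have le1 := @content_sub_fsum _ _ _ m _ setT Z
  (fun l : 'I_N * bool => cylinder hN [:: l] `&` Z) finT.
apply: (le_trans (le1 _ _ cover)) => //.
- by move=> l _; exact: measurableI.
- by rewrite fsbig1// => l _; exact: null.
Qed.

Lemma ae_occurs : {ae m, forall xi, forall v, reduced v -> occurs v xi}.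
Proof.
(* There are countably many words; [unpickle] indexes the exceptional null sets by natural numbers,
   with a trivial condition at numbers that code no word. *)
pose P (n : nat) (xi : boundary hN) := if unpickle n is Some v
  then reduced (v : seq ('I_N * bool)) -> occurs v xi else True.
have : {ae m, forall xi, forall n, P n xi}.
  apply: ae_foralln => n; rewrite /P; case: (unpickle n) => [v|]; last exact: aeW.
  have [rv|nrv] := boolP (reduced (v : seq (letter N))); last by apply: aeW.
  apply: negligibleS (negligible_avoid rv) => xi /= H occ.
  by apply: H.
apply: negligibleS => xi /= nall all; apply: nall => v rv.
by have := all (pickle (v : seq ('I_N * bool))); rewrite /P pickleK; exact.
Qed.

End Occurrences.

(** * Translation lengths *)

(** If at most one of the [A]s and at most one of the [B]s fail, then some [A] and some [B] with
    different indices hold. It will select two distinct directions at a point. *)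
Lemma distinct_choice (A1 A2 A3 B1 B2 B3 C : Prop) :
  A1 \/ A2 -> A1 \/ A3 -> A2 \/ A3 -> B1 \/ B2 -> B1 \/ B3 -> B2 \/ B3 ->
  (A1 -> B2 -> C) -> (A1 -> B3 -> C) -> (A2 -> B1 -> C) -> (A2 -> B3 -> C) ->
  (A3 -> B1 -> C) -> (A3 -> B2 -> C) -> C.
Proof.
move=> [?|?] [?|?] [?|?] [?|?] [?|?] [?|?] c12 c13 c21 c23 c31 c32;
  first [exact: c12 | exact: c13 | exact: c21 | exact: c23 | exact: c31 | exact: c32].
Qed.

(** * A base point whose displacements are read off from translation lengths *)

Section BasePoint.
Local Open Scope ring_scope.
Context {R : realType} {F : groupType} (T : cv R F).
Implicit Types (x y z p q : tree T) (g h k : F).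
Local Notation d := (@mdist R (tree T)).
Local Notation treeT := (tree_Rtree T).
Local Notation tl := (translation_length T).

(* [p] lies on the axis of [g], and the segments from [p] to [h p] and
   [h^-1 p] leave that axis at [p] *)
Definition projection_point p g h :=
  [/\ turn p g g^-1%g = 0, turn p g h = 0, turn p g^-1%g h = 0,
      turn p g h^-1%g = 0 & turn p g^-1%g h^-1%g = 0].

(** A positive product means that [y] and [y'] leave [p] in the same direction, and whether a
    product at [p] vanishes depends on directions only. *)
Lemma gromov0_transfer p y y' z :
  0 < gromov p y y' -> gromov p y z = 0 -> gromov p y' z = 0.
Proof.
move=> yy' yz; rewrite gromovC -yz (gromovC p y z).
by apply: (gromov_isosceles treeT); rewrite (gromovC p z y) yz.
Qed.

(** Take for [p] the centre of [g x], [g^-1 x] and [h x], which is within [2 * C] of [x]. An element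
    [k] moving [x] by more than [6 * C] sends [p] in the direction of [k x], so the configuration
    seen from [p] is that of the images of [x]; the last hypothesis puts [h^-1 x] in the direction
    of [h x]. *)
Lemma projection_point_ex x C g h :
  turn x g g^-1%g <= C -> turn x g h <= C -> turn x g^-1%g h <= C ->
  6 * C < disp x g -> 6 * C < disp x h -> 6 * C < turn x h h^-1%g ->
  exists p, projection_point p g h.
Proof.
move=> gg gh g'h Lg Lh hh.
have C0 : 0 <= C := le_trans (turn_ge0 x g h) gh.
have [p [b12 b13 b23]] := tripod treeT (act T g x) (act T g^-1%g x) (act T h x).
have D2 : d x p <= 2 * C.
  have := triangle_via x (act T g x) (act T h x).
  have := triangle_via x (act T g^-1%g x) (act T h x).
  rewrite (metric_sym (act T g x) x) (metric_sym (act T g^-1%g x) x).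
  rewrite (dist_btw treeT x b12) ge_max; move: gg gh g'h b12 b13 b23.
  rewrite /turn /gromov /btw (metric_sym p (act T g x)) (metric_sym p (act T g^-1%g x)).
  by move=> *; apply/andP; split; lra.
have dir k : 6 * C < disp x k -> 0 < gromov p (act T k x) (act T k p).
  move=> Lk; have := triangle_via p x (act T k x); move: Lk.
  have := triangle_via (act T k p) p (act T k x).
  rewrite /gromov /disp !act_isometry (metric_sym p x); lra.
have z (y y' : tree T) : btw y p y' -> gromov p y y' = 0.
  by rewrite /btw /gromov (metric_sym y p); lra.
have Lg' : 6 * C < disp x g^-1%g by rewrite dispV.
have Lh' : 6 * C < disp x h^-1%g by rewrite dispV.
have hh' : 0 < gromov p (act T h x) (act T h^-1%g x).
  have := gromov_base x p (act T h x) (act T h^-1%g x).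
  by move: hh; rewrite /turn; lra.
have go k y : 6 * C < disp x k ->
    gromov p (act T k x) y = 0 -> gromov p (act T k p) y = 0.
  by move=> /dir; exact: gromov0_transfer.
have gz := z _ _ b12; have ghz := z _ _ b13; have g'hz := z _ _ b23.
have tr k l : 6 * C < disp x k -> 6 * C < disp x l ->
    gromov p (act T k x) (act T l x) = 0 -> turn p k l = 0.
  move=> Lk Ll kl; apply: (go) => //; rewrite gromovC.
  by apply: (go) => //; rewrite gromovC.
exists p; split; apply: tr => //.
- by rewrite gromovC; apply: gromov0_transfer hh' _; rewrite gromovC.
- by rewrite gromovC; apply: gromov0_transfer hh' _; rewrite gromovC.
Qed.

(** At a projection point [p], the axes of these elements pass through [p] and realise all six
    ordered pairs of distinct directions among those of [g p], [g^-1 p] and [h p]. *)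
Definition probes g h : seq F :=
  [:: g; g^-1; h * g; (h * g)^-1; h * g^-1; (h * g^-1)^-1]%g.

(** The inequality is the triangle inequality at [z p], as [p] is on the axis of [z]. Equality holds
    when the cyclic word [z k] has no backtracking at either corner, that is, when [k p] avoids the
    direction of [z^-1 p] and [k^-1 p] that of [z p]. *)
Lemma probesP p g h : g <> 1%g -> h <> 1%g -> projection_point p g h ->
  (forall z k : F, z \in probes g h -> tl (z * k)%g <= tl z + disp p k) /\
  (forall k, k <> 1%g ->
    exists2 z, z \in probes g h & tl (z * k)%g = tl z + disp p k).
Proof.
move=> g1 h1 [tgg' tgh tg'h tgh' tg'h'].
have Lg := disp_gt0 p g1; have Lh := disp_gt0 p h1.
(* The axis of [z] comes to [p] from the direction of [i p] and goes on in that of [j p]. *)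
pose dir (z i j : F) := 0 < turn p z^-1%g i /\ 0 < turn p z j.
have transfer i j k : 0 < turn p i j -> turn p i k = 0 -> turn p j k = 0.
  exact: gromov0_transfer.
have dirV (z i j : F) : dir z i j -> dir z^-1%g j i by rewrite /dir invgK => -[].
have turnxx k : turn p k k = disp p k by exact: gromov_xx.
have dg : dir g g^-1%g g by rewrite /dir !turnxx dispV.
have dhg : dir (h * g)%g g^-1%g h.
  split; rewrite turnC.
    by rewrite invgM turn_mull dispV invgK tgh' subr0.
  by rewrite turn_mull turnC tgh' subr0.
have dhg' : dir (h * g^-1)%g g h.
  split; rewrite turnC.
    by rewrite invgM invgK turn_mull tg'h' subr0.
  by rewrite turn_mull turnC tg'h' subr0.
have tl_dir (z i j : F) : dir z i j -> turn p i j = 0 -> tl z = disp p z.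
  move=> [zi zj] ij; apply: tl_disp; rewrite turnC.
  rewrite (transfer i)//; first by rewrite turnC.
  by rewrite turnC (transfer j)// turnC.
have zgg' : turn p g^-1%g g = 0 by rewrite turnC.
have zhg : turn p h g = 0 by rewrite turnC.
have zhg' : turn p h g^-1%g = 0 by rewrite turnC.
have tlE (z : F) : z \in probes g h -> tl z = disp p z.
  rewrite !inE => /or4P[/eqP->|/eqP->|/eqP->|/or3P[/eqP->|/eqP->|/eqP->]].
  - exact: tl_dir dg zgg'.
  - exact: tl_dir (dirV _ _ _ dg) tgg'.
  - exact: tl_dir dhg tg'h.
  - exact: tl_dir (dirV _ _ _ dhg) zhg'.
  - exact: tl_dir dhg' tgh.
  - exact: tl_dir (dirV _ _ _ dhg') zhg.
split=> [z k zP|k k1].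
  have := tl_le p (z * k)%g; have := turn_ge0 p z^-1%g k.
  by rewrite disp_mul (tlE z)//; lra.
(* of the three directions at [p] at most one is that of [k p], and at most
   one is that of [k^-1 p] *)
have Lk := disp_gt0 p k1.
have use (z i j : F) : z \in probes g h -> dir z i j -> turn p i j = 0 ->
    turn p i k = 0 -> turn p j k^-1%g = 0 ->
    exists2 z, z \in probes g h & tl (z * k)%g = tl z + disp p k.
  move=> zP zd ij ik jk; exists z => //; case: (zd) => zi zj.
  have e1 : turn p z^-1%g k = 0 by apply: transfer ik; rewrite turnC.
  have e2 : turn p k^-1%g z = 0.
    by rewrite turnC; apply: transfer jk; rewrite turnC.
  have Lz : 0 < disp p z.
    by apply: lt_le_trans zj _; exact: gromov_lel.
  rewrite (@tl_mul _ _ T p z k) ?e1 ?e2 ?addr0//.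
  by rewrite (tlE z)//; lra.
have two (i j q : F) : turn p i j = 0 -> turn p i q = 0 \/ turn p j q = 0.
  move=> ij; have [->|ne] := eqVneq (turn p i q) 0; first by left.
  right; rewrite turnC; apply: (transfer i) ij.
  by rewrite lt_neqAle eq_sym ne turn_ge0.
have P1 : g \in probes g h by rewrite !inE eqxx.
have P2 : g^-1%g \in probes g h by rewrite !inE eqxx !orbT.
have P3 : (h * g)%g \in probes g h by rewrite !inE eqxx !orbT.
have P4 : (h * g)^-1%g \in probes g h by rewrite !inE eqxx !orbT.
have P5 : (h * g^-1)%g \in probes g h by rewrite !inE eqxx !orbT.
have P6 : (h * g^-1)^-1%g \in probes g h by rewrite !inE eqxx !orbT.
have u1 := use _ _ _ P1 dg zgg'.
have u2 := use _ _ _ P2 (dirV _ _ _ dg) tgg'.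
have u3 := use _ _ _ P3 dhg tg'h.
have u4 := use _ _ _ P4 (dirV _ _ _ dhg) zhg'.
have u5 := use _ _ _ P5 dhg' tgh.
have u6 := use _ _ _ P6 (dirV _ _ _ dhg') zhg.
(* The directions are numbered [g], [g^-1], [h]; each [u] settles the case of its ordered pair. *)
exact: (distinct_choice (two _ _ k tgg') (two _ _ k tgh) (two _ _ k tg'h)
  (two _ _ k^-1%g tgg') (two _ _ k^-1%g tgh) (two _ _ k^-1%g tg'h)
  u2 u5 u1 u3 u6 u4).
Qed.

End BasePoint.

(** The probe that attains the maximum in one tree gives a lower bound in the other, so [p1] and
    [p2] have equal displacements. *)
Lemma tl_rigid (R : realType) (F : groupType) (T1 T2 : cv R F) p1 p2 (g h : F) :
  g <> 1%g -> h <> 1%g ->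
  @projection_point R F T1 p1 g h -> @projection_point R F T2 p2 g h ->
  (forall k, translation_length T1 k = translation_length T2 k) -> cv_eq T1 T2.
Proof.
move=> g1 h1 /(probesP g1 h1)[le1 eq1] /(probesP g1 h1)[le2 eq2] E.
apply: (@disp_rigid _ _ _ _ p1 p2) => k.
have [->|/eqP k1] := eqVneq k 1%g; first by rewrite !disp1.
apply/eqP; rewrite eq_le; apply/andP; split.
- by have [z zP] := eq1 k k1; rewrite !E => zk; have := le2 z k zP; rewrite zk lerD2l.
- by have [z zP] := eq2 k k1; rewrite -!E => zk; have := le1 z k zP; rewrite zk lerD2l.
Qed.

(** * Translation lengths along a trajectory *)

Section Main.
Local Open Scope ring_scope.
Context {R : realType} {N : nat} {hN : (1 < N)%N} {F : groupType} {a : 'I_N -> F}.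
Hypothesis ha : free_basis a.
Implicit Types (xi : boundary hN) (T : cv R F) (u v w c : seq (letter N)) (g h : F).
Local Notation val := (word_val a).

Let la : letter N := (Ordinal (ltnW hN), true).
Let lb : letter N := (Ordinal hN, true).

(** A periodic trajectory containing the word [l ... l] of a whole period has [l] as first letter of
    [e], and this cannot hold for two letters. With [e] the inverse of [c], it bounds the
    cancellation at the closing corner of [s c^m]. *)
Lemma leaves_periodic xi e : e != [::] -> (forall v, reduced v -> occurs v xi) ->
  exists i, xi i != nth la e (i %% size e).
Proof.
move=> e0 occ; apply: contrapT => per.
have {}per i : xi i = nth la e (i %% size e).
  by apply/eqP/negPn/negP => ne; apply: per; exists i.
have n0 : (0 < size e)%N by case: e e0 {per}.
have head l : nth la e 0 = l.
  have [i] := occ _ (reduced_nseq (size e) l); rewrite size_nseq => E.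
  (* Offset of the next multiple of the period, which still falls inside the block of letters
     [l]. *)
  pose j := ((size e - i %% size e) %% size e)%N.
  have jn : (j < size e)%N by rewrite ltn_mod.
  have ij0 : ((i + j) %% size e = 0)%N.
    rewrite /j modnDmr -modnDml subnKC ?modnn//.
    by rewrite ltnW// ltn_mod.
  have := congr1 (fun w => nth la w (i + j)) E.
  rewrite nth_initial_word ?ltn_add2l// per ij0 nth_cat size_initial_word.
  by rewrite ltnNge leq_addr /= addKn nth_nseq jn.
by have := head la; rewrite (head (linv la)).
Qed.

(** With [p] on the axis of [c], the power [c^k] moves [p] by [k] times the translation length. The
    corner between [s] and [c^m] is bounded by [C1] because the word is reduced there; the closing
    corner is bounded because [s] and the inverse of [c^m] differ at the letter [i], chosen before
    [n] and [m]. *)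
Lemma tl_increment T c xi : c != [::] -> reduced (c ++ c) ->
  (forall v, reduced v -> occurs v xi) ->
  exists M, forall n m, (M <= n)%N -> (M <= m)%N ->
    initial_word xi (n + m.+1 * size c) = initial_word xi n ++ wpow c m.+1 ->
    translation_length T (val (initial_word xi (n + m.+1 * size c))) -
    translation_length T (val (initial_word xi (n + m * size c))) =
    translation_length T (val c).
Proof.
move=> c0 rcc occ; set g := val c; have rc : reduced c := reduced_catl rcc.
have g1 : g <> 1%g.
  rewrite -(val_nil (a := a)) => /(val_reduced_inj ha rc) => /(_ isT) E.
  by rewrite E in c0.
have [p [p0 pE]] := axis_exists T g1; have L0 := disp_gt0 p g1.
have [C1 C10 hC1] := bounded_cancellation ha p.
have [C2 C20 hC2] := turn_diverge ha p.
have c'0 : invw c != [::] by rewrite -size_eq0 size_invw size_eq0.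
have [i xii] := leaves_periodic c'0 occ.
rewrite size_invw in xii.
pose B := C1 + i.+1%:R * C2.
have B0 : 0 <= B by rewrite addr_ge0// mulr_ge0.
have [K hK] := proper_orbit_lt ha p B.
pose M1 := (Num.truncn (B / disp p g)).+1.
have M1P : B < M1%:R * disp p g.
  have /andP[_] := @truncn_itv R (B / disp p g) (divr_ge0 B0 (ltW L0)).
  by rewrite ltr_pdivrMr.
have sc : (0 < size c)%N by case: (c) c0.
(* [M1] and [K] make [c^m] and [s] displace [p] by more than the total backtracking [B]; [i.+1]
   makes both words reach the letter where they diverge. *)
exists (M1 + i.+1 + K.+1)%N => n m Mn Mm; set s := initial_word xi n => E.
have [i_n Kn] : (i < n)%N /\ (K < n)%N by clear -Mn; lia.
have [i_m M1m] : (i < m)%N /\ (M1 <= m)%N by clear -Mm; lia.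
have E' : initial_word xi (n + m * size c) = s ++ wpow c m.
  have := @initial_word_catl _ _ xi (s ++ wpow c m) c.
  rewrite size_cat size_initial_word size_wpow -catA => -> //.
  have -> : wpow c m ++ c = wpow c m.+1 by rewrite -addn1 wpowD /wpow /= cats0.
  by rewrite -E mulSn addnAC addnA.
have big k : (m <= k)%N -> B < k%:R * disp p g.
  move=> mk; apply: lt_le_trans M1P _; rewrite ler_wpM2r ?ler_nat//; first exact: ltW.
  exact: leq_trans mk.
have Ls : B < disp p (val s).
  by apply: hK; rewrite ?reduced_initial_word// size_initial_word.
have dk k : disp p (g ^+ k)%g = k%:R * disp p g by exact: disp_expn.
have alpha k : reduced (s ++ wpow c k) -> turn p (val s)^-1%g (g ^+ k)%g <= C1.
  move=> rk; rewrite -val_invw -val_wpow; apply: hC1.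
  by rewrite invwK.
have beta k : (m <= k)%N -> turn p (g ^+ k)^-1%g (val s) <= i.+1%:R * C2.
  move=> mk; rewrite -val_wpow -val_invw.
  have ik : (i < k * size c)%N by exact: leq_trans (leq_trans i_m mk) (leq_pmulr _ sc).
  apply: (hC2 i la).
  - by rewrite reduced_invw; exact: reduced_wpow.
  - exact: reduced_initial_word.
  - by rewrite size_invw size_wpow.
  - by rewrite size_initial_word.
  - by rewrite invw_wpow nth_wpow ?size_invw// nth_initial_word// eq_sym.
have formula k : (m <= k)%N -> reduced (s ++ wpow c k) ->
    translation_length T (val (s ++ wpow c k)) =
    disp p (val s) + k%:R * disp p g -
    2 * turn p (val s)^-1%g (g ^+ k)%g - 2 * turn p (g ^+ k)^-1%g (val s).
  move=> mk rk; have := alpha k rk; have := beta k mk; have := big k mk.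
  move=> bk b1 b2; have := @tl_mul _ _ T p (val s) (g ^+ k)%g.
  rewrite dk val_cat val_wpow -/g; apply; move: Ls bk; rewrite /B; lra.
have rm : reduced (s ++ wpow c m) by rewrite -E' reduced_initial_word.
have rm1 : reduced (s ++ wpow c m.+1) by rewrite -E reduced_initial_word.
have bm := big m (leqnn m).
(* The paths to [c^m p] and [c^m.+1 p] agree for longer than the bound on the turn, so the corner is
   the same for both. *)
have aE : turn p (val s)^-1%g (g ^+ m.+1)%g = turn p (val s)^-1%g (g ^+ m)%g.
  apply: turn_isosceles; apply: (le_lt_trans (alpha m rm)).
  have -> : turn p (g ^+ m)%g (g ^+ m.+1)%g = m%:R * disp p g.
    by rewrite turnE !dk expgSr mulKg -natr1; lra.
  by apply: le_lt_trans bm; rewrite /B lerDl mulr_ge0.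
have bE : turn p (g ^+ m.+1)^-1%g (val s) = turn p (g ^+ m)^-1%g (val s).
  rewrite turnC [in RHS]turnC; apply: turn_isosceles; rewrite turnC.
  apply: (le_lt_trans (beta m (leqnn m))).
  have -> : turn p (g ^+ m)^-1%g (g ^+ m.+1)^-1%g = m%:R * disp p g.
    by rewrite turnE !dispV !dk invgK expgS invgM mulVKg dispV -natr1; lra.
  by apply: le_lt_trans bm; rewrite /B lerDr.
rewrite E E' !formula// aE bE -pE -natr1; lra.
Qed.

Lemma tl_determined T1 T2 xi n0 : (forall v, reduced v -> occurs v xi) ->
  (forall n, (n0 <= n)%N -> translation_length T1 (walk a xi n) =
     translation_length T2 (walk a xi n)) ->
  forall g, translation_length T1 g = translation_length T2 g.
Proof.
move=> occ eqS g; have [w rw <-] := val_reduced_ex ha g.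
have [u [c [-> rcc]]] := cyclically_reduced_conj rw.
rewrite !val_cat val_invw mulgA !tl_conj.
have [->|c0] := eqVneq c [::]; first by rewrite val_nil !tl1.
have [M1 h1] := tl_increment T1 c0 rcc occ.
have [M2 h2] := tl_increment T2 c0 rcc occ.
pose M := (M1 + M2 + n0)%N.
(* The first [M] copies of [c] go into the prefix, making its length [n] at least [M]; the other
   [M.+1] are the periodic tail. *)
have [i] := occ _ (reduced_wpow (M + M.+1) rcc).
rewrite wpowD size_cat !size_wpow => E.
have sc : (0 < size c)%N by case: (c) c0.
pose n := (i + M * size c)%N.
have nM : (M <= n)%N by apply: leq_trans (leq_pmulr M sc) _; rewrite leq_addl.
have En : initial_word xi n = initial_word xi i ++ wpow c M.
  have := @initial_word_catl _ _ xi (initial_word xi i ++ wpow c M) (wpow c M.+1).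
  rewrite size_cat size_initial_word !size_wpow -catA => -> //.
  by rewrite -addnA.
have EM : initial_word xi (n + M.+1 * size c) = initial_word xi n ++ wpow c M.+1.
  by rewrite En -catA -E addnA.
have eqk k : (n <= k)%N -> translation_length T1 (val (initial_word xi k)) =
    translation_length T2 (val (initial_word xi k)).
  by move=> nk; apply: eqS; apply: leq_trans nk; apply: leq_trans nM; rewrite leq_addl.
have M1n : (M1 <= M)%N by rewrite /M; lia.
have M2n : (M2 <= M)%N by rewrite /M; lia.
rewrite -(h1 n M _ _ EM) ?(leq_trans _ nM)// -(h2 n M _ _ EM) ?(leq_trans _ nM)//.
by rewrite !eqk// leq_addr.
Qed.

(* conjugating [a] by [b^n] moves its axis off the axis of [a^n] *)
Definition power_a n : seq (letter N) := nseq n la.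
Definition conj_a n : seq (letter N) := nseq n lb ++ la :: nseq n (linv lb).

Lemma reduced_conj_a n : reduced (conj_a n).
Proof.
have neq : (la.1 == lb.1) = false by [].
rewrite /conj_a reduced_cat_cons; apply/andP; split.
  case: n => [|n]; first by [].
  rewrite -[n.+1]addn1 nseqD -cats1 -catA reduced_cat_cons.
  rewrite [rcons _ _](_ : _ = nseq (n + 1) lb); last by rewrite nseqD cats1.
  by apply/andP; split; [exact: reduced_nseq|].
case: n => // n; apply/andP; split; first by [].
exact: (reduced_nseq n.+1 (linv lb)).
Qed.

Lemma reduced_diverge_turn T (x : tree T) C :
  (forall u v, reduced (invw u ++ v) -> turn x (val u) (val v) <= C) ->
  forall l l' u v, l != l' -> reduced (l :: u) -> reduced (l' :: v) ->
  turn x (val (l :: u)) (val (l' :: v)) <= C.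
Proof. by move=> hC l l' u v ll' ru rv; apply: hC; exact: reduced_diverge. Qed.

(** Words with different first letters have bounded turns, and long words have large displacements.
    The conjugate and its inverse both begin with [b^n], so their turn is large as well. *)
Lemma projection_point_words T : exists M, forall n, (M <= n)%N ->
  exists p : tree T, projection_point p (val (power_a n)) (val (conj_a n)).
Proof.
have [x _] := tree_neq0 T.
have [C C0 hC] := bounded_cancellation ha x.
have div := reduced_diverge_turn hC.
(* One [C] above the required [6 * C], to be lost in [deep]. *)
have [K hK] := proper_orbit_lt ha x (7 * C).
exists K.+1 => n Kn.
have inva : (val (power_a n))^-1%g = val (nseq n (linv la)).
  by rewrite -val_invw /invw map_nseq rev_nseq.
pose cj l := nseq n lb ++ l :: nseq n (linv lb).
have invc : (val (conj_a n))^-1%g = val (cj (linv la)).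
  rewrite -val_invw /cj /conj_a /invw map_cat /= !map_nseq linvK rev_cat rev_cons.
  by rewrite !rev_nseq cat_rcons.
have rc' : reduced (cj (linv la)).
  have := reduced_conj_a n; rewrite -reduced_invw.
  rewrite /cj /conj_a /invw map_cat /= !map_nseq linvK rev_cat rev_cons.
  by rewrite !rev_nseq cat_rcons.
have ab : la != lb by [].
have a'b : linv la != lb by [].
have aa' : la != linv la by [].
case: n Kn inva @cj invc rc' => [//|n] Kn inva cj invc rc'.
have rn l := reduced_nseq n.+1 l.
have rc := reduced_conj_a n.+1.
have Lpow l : 7 * C < disp x (val (nseq n.+1 l)).
  by apply: hK => //; rewrite size_nseq.
have deep l : reduced (cj l) -> disp x (val (nseq n.+1 lb)) - C <=
    turn x (val (nseq n.+1 lb)) (val (cj l)).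
  move=> rl; rewrite val_cat turn_mull lerD2l lerN2 -val_invw; apply: hC.
  by rewrite invwK.
apply: (projection_point_ex (x := x) (C := C)).
- by rewrite inva; exact: (div la (linv la) _ _ aa' (rn _ la) (rn _ (linv la))).
- exact: (div la lb _ _ ab (rn _ la) rc).
- by rewrite inva; exact: (div (linv la) lb _ _ a'b (rn _ (linv la)) rc).
- by have := Lpow la; rewrite /power_a; lra.
- have : 7 * C < disp x (val (conj_a n.+1)).
    by apply: hK => //; rewrite size_cat /= !size_nseq; lia.
  lra.
- rewrite invc; have := deep _ rc'; have := deep la rc; have := Lpow lb.
  rewrite -/(conj_a n.+1).
  have := gromov_hyp (tree_Rtree T) x (act T (val (conj_a n.+1)) x)
    (act T (val (nseq n.+1 lb)) x) (act T (val (cj (linv la))) x).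
  rewrite -!/(turn _ _ _) (turnC _ (val (conj_a _)) (val (nseq _ _))).
  by rewrite -[cj la]/(conj_a n.+1) => -[]; lra.
Qed.

Lemma spectrally_rigid_tail xi n0 : (forall v, reduced v -> occurs v xi) ->
  spectrally_rigid R [set walk a xi n | n in [set n : nat | (n0 <= n)%N]]%classic.
Proof.
move=> occ T1 T2 eqS.
have [M1 h1] := projection_point_words T1; have [M2 h2] := projection_point_words T2.
(* One exponent serves both trees; the successor makes the two words nonempty, hence nontrivial. *)
pose M := (M1 + M2).+1.
have [p1 p1P] := h1 M ltac:(lia); have [p2 p2P] := h2 M ltac:(lia).
have nt w : reduced w -> (0 < size w)%N -> val w <> 1%g.
  move=> rw w0; rewrite -(val_nil (a := a)) => /(val_reduced_inj ha rw) => /(_ isT) E.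
  by rewrite E in w0.
apply: (tl_rigid _ _ p1P p2P).
- by apply: nt; [exact: reduced_nseq|rewrite size_nseq].
- by apply: nt; [exact: reduced_conj_a|rewrite size_cat /= addnS].
- apply: (@tl_determined T1 T2 xi n0 occ) => n nn0.
  by apply: eqS; exists n.
Qed.

End Main.

Local Open Scope classical_set_scope.

Theorem theorem1p1 (R : realType) (N : nat) (hN : (1 < N)%N) (F : groupType)
    (a : 'I_N -> F) (ha : free_basis a)
    (m : probability (borel_boundary hN) R) (hm : uniform_measure m) :
  {ae m, forall xi : boundary hN, forall n0 : nat, (1 <= n0)%N ->
    spectrally_rigid R [set walk a xi n | n in [set n : nat | (n0 <= n)%N]]}.
Proof.
have := ae_occurs hm; apply: negligibleS => xi /= nall occ; apply: nall => n0 _.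
exact: (spectrally_rigid_tail ha).
Qed.
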